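(* Let $\chi\in\{\pm\}^{\binom{[6]}{3}}$ be one of the following four uniform realizable rank-3 chirotopes, written as sign vectors with the 3-subsets in lexicographic order $123<124<125<126<134<135<136<145<146<156<234<235<236<245<246<256<345<346<356<456$: (1) $(++++++++--+++++-++++)$; (2) $(++++++++++++++++++--)$; (3) $(+++++++++++++++++++-)$; (4) $(++++++++++++++++++++)$. Then $\mathrm{Dr}^\chi(3,6)$ modulo its lineality space is a pure $4$-dimensional polyhedral fan, it equals $\mathrm{Trop}^\chi\mathrm{G}(3,6)$, and its f-vector (numbers of cones of dimensions $1,2,3,4$ modulo lineality) is respectively: (1) $(15,60,90,45)$; (2) $(15,60,89,44)$; (3) $(14,55,82,41)$; (4) $(16,66,98,48)$.
   Context: For a real polynomial $f$ in Plücker variables $p_I$, $f^\chi_\pm$ is the sum of the terms of $f$ whose evaluation at $p=\chi$ has sign $\pm1$; $\mathrm{Trop}(h)(x)=\min\alpha\cdot x$ over exponent vectors of monomials of $h$; $\mathrm{Trop}^\chi V(f)=\{x:\mathrm{Trop}(f^\chi_+)(x)=\mathrm{Trop}(f^\chi_-)(x)\}$. $\mathrm{Dr}^\chi(k,n)=\bigcap_{f\in P_{k,n}}\mathrm{Trop}^\chi V(f)$ with $P_{k,n}$ the three-term Plücker relations of $\mathrm{G}(k,n)$, and $\mathrm{Trop}^\chi\mathrm{G}(k,n)=\bigcap_{f\in I_{k,n}}\mathrm{Trop}^\chi V(f)$ with $I_{k,n}$ the Plücker ideal. The lineality space is the image of $x\mapsto(\sum_{i\in I}x_i)_I$, $x\in\mathbb{R}^n$.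 *)

(* Defs.v *)
(* MathComp with MathComp-Analysis; mpoly has to be imported before the
   latter, otherwise their notations clash. *)
From HB Require Import structures.
From mathcomp Require Import all_boot all_order all_algebra.
From mathcomp Require Import mpoly.
From mathcomp Require Import boolp classical_sets cardinality reals.
From mathcomp Require Import constructive_ereal.

Set Implicit Arguments.
Unset Strict Implicit.
Unset Printing Implicit Defensive.

Import Order.TTheory GRing.Theory Num.Theory.

Local Open Scope classical_set_scope.
Local Open Scope card_scope.
Local Open Scope ring_scope.

(** * Cones and fans in R^N *)

Definition dotp (R : realType) (N : nat) (a x : 'rV[R]_N) : R :=
  \sum_i a 0 i * x 0 i.

Definition polyhedral_cone (R : realType) (N : nat) (C : set 'rV[R]_N) : Prop :=
  exists A : seq 'rV[R]_N, C = [set x | forall a, a \in A -> 0 <= dotp a x].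

(* [a = 0] is allowed, so every cone is a face of itself. *)
Definition is_face (R : realType) (N : nat) (F C : set 'rV[R]_N) : Prop :=
  exists2 a : 'rV[R]_N, (forall x, C x -> 0 <= dotp a x) &
    F = C `&` [set x | dotp a x = 0].

Definition is_fan (R : realType) (N : nat) (Sigma : set (set 'rV[R]_N)) : Prop :=
  [/\ finite_set Sigma,
      forall C, Sigma C -> polyhedral_cone C,
      forall C F, Sigma C -> is_face F C -> Sigma F &
      forall C D, Sigma C -> Sigma D ->
        is_face (C `&` D) C /\ is_face (C `&` D) D].

Definition fan_support (R : realType) (N : nat) (Sigma : set (set 'rV[R]_N)) :
  set 'rV[R]_N := \bigcup_(C in Sigma) C.

(* The linear span of [A] has dimension [d]; for a cone this is its dimension. *)
Definition has_dim (R : realType) (N : nat) (A : set 'rV[R]_N) (d : nat) : Prop :=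
  exists2 U : {vspace 'rV[R]_N},
    (forall x, A x -> x \in U) /\
    (forall W : {vspace 'rV[R]_N}, (forall x, A x -> x \in W) -> (U <= W)%VS) &
    \dim U = d.

(* The image of [C] in the quotient of R^N by the linear subspace [L] has
   dimension [d]. *)
Definition has_dim_mod (R : realType) (N : nat) (L C : set 'rV[R]_N) (d : nat) :
    Prop :=
  exists2 e, has_dim L e & has_dim (C `|` L) (d + e)%N.

(* [Sigma] is the preimage in R^N of a fan of pointed cones in R^N / L: cones
   of R^N / L correspond to cones of R^N containing L, and a cone is pointed
   modulo L when its lineality space is exactly L. *)
Definition is_fan_mod (R : realType) (N : nat) (L : set 'rV[R]_N)
    (Sigma : set (set 'rV[R]_N)) : Prop :=
  is_fan Sigma /\ forall C, Sigma C -> [set x | C x /\ C (- x)] = L.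

Definition pure_mod (R : realType) (N : nat) (L : set 'rV[R]_N)
    (Sigma : set (set 'rV[R]_N)) (d : nat) : Prop :=
  forall C, Sigma C -> (forall D, Sigma D -> C `<=` D -> D = C) ->
    has_dim_mod L C d.

Definition num_cones_mod (R : realType) (N : nat) (L : set 'rV[R]_N)
    (Sigma : set (set 'rV[R]_N)) (d c : nat) : Prop :=
  [set C | Sigma C /\ has_dim_mod L C d] #= `I_c.

(** * Signed tropicalization *)

Definition exp_dot (R : realType) (N : nat) (m : 'X_{1..N}) (x : 'rV[R]_N) : R :=
  \sum_i (m i)%:R * x 0 i.

(* The minimum over the empty set of monomials (h = 0) is +oo. *)
Definition Trop (R : realType) (N : nat) (h : {mpoly R[N]}) (x : 'rV[R]_N) :
    \bar R :=
  \big[Order.min/+oo%E]_(m <- msupp h) (exp_dot m x)%:E.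

Definition sign_part (R : realType) (N : nat) (chi : 'I_N -> int) (s : R)
    (f : {mpoly R[N]}) : {mpoly R[N]} :=
  \sum_(m <- msupp f |
        Num.sg ((f@_m *: 'X_[m]).@[fun i => (chi i)%:~R]) == s)
     f@_m *: 'X_[m].

Definition TropV (R : realType) (N : nat) (chi : 'I_N -> int)
    (f : {mpoly R[N]}) : set 'rV[R]_N :=
  [set x | Trop (sign_part chi 1 f) x = Trop (sign_part chi (-1) f) x].

Definition min_terms (R : realType) (N : nat) (f : {mpoly R[N]})
    (x : 'rV[R]_N) : set 'X_{1..N} :=
  [set m | m \in msupp f /\ (exp_dot m x)%:E = Trop f x].

(* The closed cone of the common refinement of the normal fans of the Newton
   polytopes of the [f] in [P] that has [w] in its relative interior; the
   relative interior consists of the [x] with the same initial form as [w] for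
   every [f] in [P]. *)
Definition refinement_cone (R : realType) (N : nat) (P : set {mpoly R[N]})
    (w : 'rV[R]_N) : set 'rV[R]_N :=
  [set x | forall f, P f -> min_terms f w `<=` min_terms f x].

(** * Pluecker coordinates, relations and ideal *)

Definition plN (k n : nat) : nat := #|{: {I : {set 'I_n} | #|I| == k}}|.

(* The k-subset of {0, ..., n-1} that indexes the i-th coordinate. *)
Definition pl_index (k n : nat) (i : 'I_(plN k n)) :
  {I : {set 'I_n} | #|I| == k} := enum_val i.

(* The variable p_I: the sum has exactly one term when #|I| = k, and pl_var is
   used only for such I. *)
Definition pl_var (R : realType) (k n : nat) (I : {set 'I_n}) :
    {mpoly R[plN k n]} :=
  \sum_(i < plN k n | val (pl_index i) == I) 'X_i.

(* Variables are indexed by sets rather than by tuples: reordering the tuples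
   (S, a, b), ... increasingly multiplies the three terms by the same sign. *)
Definition three_term_relations (R : realType) (k n : nat) :
    set {mpoly R[plN k n]} :=
  [set f | exists (S : {set 'I_n}) (a b c d : 'I_n),
    [/\ (#|S| + 2 = k)%N,
        [&& (a < b)%N, (b < c)%N & (c < d)%N],
        [/\ a \notin S, b \notin S, c \notin S & d \notin S] &
        f = pl_var R k (S :|: [set a; b]) * pl_var R k (S :|: [set c; d])
          - pl_var R k (S :|: [set a; c]) * pl_var R k (S :|: [set b; d])
          + pl_var R k (S :|: [set a; d]) * pl_var R k (S :|: [set b; c])]].
Arguments three_term_relations R k n : clear implicits.

Definition generic_mx (R : realType) (k n : nat) :
    'M[{mpoly R[k * n]}]_(k, n) :=
  \matrix_(i, j) 'X_(mxvec_index i j).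

(* The columns of I are taken in increasing order. *)
Definition generic_minor (R : realType) (k n : nat) (i : 'I_(plN k n)) :
    {mpoly R[k * n]} :=
  let I := pl_index i in
  \det (colsub (fun j : 'I_k =>
                  enum_val (cast_ord (esym (eqP (valP I))) j))
               (generic_mx R k n)).

Definition pluecker_ideal (R : realType) (k n : nat) :
    set {mpoly R[plN k n]} :=
  [set f | f \mPo [tuple generic_minor R i | i < plN k n] = 0].
Arguments pluecker_ideal R k n : clear implicits.

Definition Dressian (R : realType) (k n : nat) (chi : 'I_(plN k n) -> int) :
    set 'rV[R]_(plN k n) :=
  \bigcap_(f in three_term_relations R k n) TropV chi f.
Arguments Dressian R {k n} chi.

Definition TropG (R : realType) (k n : nat) (chi : 'I_(plN k n) -> int) :
    set 'rV[R]_(plN k n) :=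
  \bigcap_(f in pluecker_ideal R k n) TropV chi f.
Arguments TropG R {k n} chi.

(* The fan structure on the Dressian induced by the three-term relations. *)
Definition Dressian_fan (R : realType) (k n : nat)
    (chi : 'I_(plN k n) -> int) : set (set 'rV[R]_(plN k n)) :=
  refinement_cone (three_term_relations R k n) @` Dressian R chi.
Arguments Dressian_fan R {k n} chi.

Definition lineality (R : realType) (k n : nat) : set 'rV[R]_(plN k n) :=
  range (fun x : 'rV[R]_n => \row_i \sum_(j in val (pl_index i)) x 0 j).
Arguments lineality R k n : clear implicits.

Definition lex36 : seq (seq nat) :=
  [:: [:: 1; 2; 3]; [:: 1; 2; 4]; [:: 1; 2; 5]; [:: 1; 2; 6]; [:: 1; 3; 4];
      [:: 1; 3; 5]; [:: 1; 3; 6]; [:: 1; 4; 5]; [:: 1; 4; 6]; [:: 1; 5; 6];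
      [:: 2; 3; 4]; [:: 2; 3; 5]; [:: 2; 3; 6]; [:: 2; 4; 5]; [:: 2; 4; 6];
      [:: 2; 5; 6]; [:: 3; 4; 5]; [:: 3; 4; 6]; [:: 3; 5; 6]; [:: 4; 5; 6]]%N.

(* The sign of I is the entry of [s] at the lexicographic position of I, the
   element j of 'I_6 being labelled j+1. *)
Definition chirotope36 (s : seq int) (i : 'I_(plN 3 6)) : int :=
  nth 0 s (index [seq (nat_of_ord j).+1 | j <- enum (val (pl_index i))] lex36).

(* Main.v *)
Require Import Defs.
From HB Require Import structures.
From Stdlib Require Import ZArith.
From mathcomp Require Import all_boot all_order all_algebra.
From mathcomp Require Import mpoly.
From mathcomp Require Import boolp classical_sets cardinality reals.
From mathcomp Require Import constructive_ereal.
From mathcomp Require Import sequences exp.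
From mathcomp Require Import ring lra zify ssrZ.

(** The chirotope turns each three-term relation into a tropical equation
    [x_t + x_t' = min (x_u + x_u') (x_v + x_v')], so the cell of a point of the
    Dressian is determined by the ties in these equations.  Intersecting R^20
    with the thirty equations one after the other, and subdividing so that all
    cones stay simplicial modulo their lineality space, covers the Dressian by
    finitely many integral simplicial cones; the ties at a point are read off
    from the generators that occur in it, which lists all cells.  The fan axioms
    hold for every common refinement of normal fans of Newton polytopes.

    For the inclusion of the Dressian in the tropical Grassmannian, let [x] lie
    in the closure of the maximal cell of [w], and let [z = S x + M w] with [M]
    fixed and [S] large.  Start from ten Pluecker coordinates of absolute value
    [exp (- z_I)] and obtain the other ten from three-term relations that are
    solved without cancellation of leading terms.  The ten relations used imply
    all thirty by Pfaffian syzygies, so the result is the vector of minors of a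
    real matrix, with signs [chi] and absolute values [exp (- z_I + O(1))].  A
    polynomial of the Pluecker ideal vanishes there, and letting [S] tend to
    infinity shows that its positive and negative terms have the same minimum. *)

Set Implicit Arguments.
Unset Strict Implicit.
Unset Printing Implicit Defensive.

Import Order.TTheory GRing.Theory Num.Theory.

Local Open Scope classical_set_scope.
Local Open Scope ring_scope.

(** * Coordinates of R^20 in lexicographic order *)

(** Only one half of the cone computation is proved: each cut returns cones that cover the points
    satisfying the condition, and these cones may be too large. That the final cones lie in the
    Dressian, so that every listed cell really occurs, is tested afterwards on the integer
    generators. Keeping cones simplicial keeps the lists of generators short. The chirotope enters
    by orienting the relations: the three terms never all have the same sign at [chi], so one of
    them stands alone, and in absolute values it is the sum of the other two. The obstacle in
    lifting is subtraction: solving for a factor of a summand destroys the valuation unless the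
    subtracted term is negligible. This is why [z] is pushed away from the walls by [M w]: since [w]
    is integral, every condition not tied at [w] is at least 1 there, hence at least [M] at [z]. The
    split into ten chosen and ten derived coordinates reflects the dimension 10 = 4 + 6 of a maximal
    cell, which is also the dimension of the affine cone over G(3,6). *)

Definition setkey (A : {set 'I_6}) : seq nat :=
  [seq (nat_of_ord j).+1 | j <- enum A].

Lemma mem_setkey (A : {set 'I_6}) (j : 'I_6) : (j.+1 \in setkey A) = (j \in A).
Proof.
rewrite /setkey (mem_map (f := fun j : 'I_6 => j.+1)) ?mem_enum //.
by move=> a b [] /ord_inj.
Qed.

Lemma setkey_sorted (A : {set 'I_6}) : sorted ltn (setkey A).
Proof.
rewrite /setkey sorted_map {1}/enum_mem; apply: sorted_filter.
  by move=> a b c; apply: ltn_trans.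
rewrite -enumT -(@sorted_map _ _ (fun j : 'I_6 => j.+1) ltn).
rewrite (map_comp S val) val_enum_ord.
by vm_compute.
Qed.

Lemma setkey_inj : injective setkey.
Proof. by move=> A B e; apply/setP => j; rewrite -!mem_setkey e. Qed.

Lemma setkey_eq (A : {set 'I_6}) (l : seq nat) :
  sorted ltn l -> all (fun k => 0 < k <= 6)%N l ->
  (forall j : 'I_6, (j \in A) = (j.+1 \in l)) -> setkey A = l.
Proof.
move=> ls lb lA; apply: (@irr_sorted_eq _ ltn ltn_trans ltnn _ _ (setkey_sorted A) ls).
move=> k; apply/idP/idP.
  by case/mapP=> j; rewrite mem_enum lA => ? ->.
move=> kl; have /andP[k0 k6] := allP lb _ kl.
have k1 : (k.-1 < 6)%N by case: k k0 k6 {kl}.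
have -> : k = (Ordinal k1).+1 by rewrite /= prednK.
by rewrite mem_setkey lA /= prednK.
Qed.

Lemma setkey_lex36 (A : {set 'I_6}) : #|A| = 3%N -> setkey A \in lex36.
Proof.
move=> cA; have sA := setkey_sorted A.
have szA : size (setkey A) = 3%N by rewrite size_map -cardE.
have : all (fun k => k \in iota 1 6) (setkey A).
  by apply/allP=> k /mapP[j _ ->]; rewrite mem_iota /= add1n ltnS.
move: (setkey A) szA sA => [|a [|b [|c []]]] //= _ /and3P[ab bc _].
case/and4P=> aI bI cI _.
have : all (fun a => all (fun b => all (fun c =>
   (a < b)%N && (b < c)%N ==> ([:: a; b; c] \in lex36))
   (iota 1 6)) (iota 1 6)) (iota 1 6) by vm_compute.
by move=> /allP/(_ _ aI)/allP/(_ _ bI)/allP/(_ _ cI); rewrite ab bc.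
Qed.

Lemma plN36 : plN 3 6 = 20%N.
Proof.
rewrite /plN card_sig; transitivity 'C(#|'I_6|, 3); last by rewrite card_ord.
rewrite -card_draws.
by apply: eq_card => A; rewrite !inE.
Qed.

Definition lexpos (i : 'I_(plN 3 6)) : nat :=
  index (setkey (val (pl_index i))) lex36.

Lemma lexpos_lt i : (lexpos i < 20)%N.
Proof.
rewrite -[20%N]/(size lex36) index_mem; apply: setkey_lex36.
exact/eqP/(valP (pl_index i)).
Qed.

Lemma nth_lexpos i : nth [::] lex36 (lexpos i) = setkey (val (pl_index i)).
Proof. by apply: nth_index; rewrite -index_mem; apply: lexpos_lt. Qed.

Lemma lexpos_inj : injective lexpos.
Proof.
move=> i j e; have := nth_lexpos i; rewrite e nth_lexpos.
by move/setkey_inj/val_inj/enum_val_inj.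
Qed.

(** The default, reached only for [k >= 20], makes [ix] total, so that relations can be encoded by
    plain numbers and tested by computation. *)
Definition ix (k : nat) : 'I_(plN 3 6) :=
  odflt (cast_ord (esym plN36) ord0) [pick i | lexpos i == k].

Lemma lexposK i : ix (lexpos i) = i.
Proof.
rewrite /ix; case: pickP => [j /eqP/lexpos_inj //|/(_ i)].
by rewrite eqxx.
Qed.

Lemma ixK k : (k < 20)%N -> lexpos (ix k) = k.
Proof.
move=> k20; pose f i := Ordinal (lexpos_lt i).
have [||g _ gK] := @inj_card_bij _ _ f.
- by move=> i j e; apply: lexpos_inj; exact: (congr1 (@nat_of_ord 20) e).
- by rewrite !card_ord plN36.
have e : lexpos (g (Ordinal k20)) = k.
  exact: (congr1 (@nat_of_ord 20) (gK (Ordinal k20))).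
by rewrite -{1}e lexposK.
Qed.

Lemma ix_inj k l : (k < 20)%N -> (l < 20)%N -> (ix k == ix l) = (k == l).
Proof.
by move=> k20 l20; apply/eqP/eqP=> [/(congr1 lexpos)|->//]; rewrite !ixK.
Qed.

Lemma setkey_ix k : (k < 20)%N ->
  setkey (val (pl_index (ix k))) = nth [::] lex36 k.
Proof. by move=> k20; rewrite -nth_lexpos ixK. Qed.

Lemma pl_var_ix (R : realType) (A : {set 'I_6}) : #|A| = 3%N ->
  pl_var R 3 A = 'X_(ix (index (setkey A) lex36)).
Proof.
move=> cA; have lt20 : (index (setkey A) lex36 < 20)%N.
  by rewrite -[20%N]/(size lex36) index_mem; apply: setkey_lex36.
rewrite /pl_var (big_pred1 (ix (index (setkey A) lex36))) // => i.
rewrite /= -(inj_eq setkey_inj); apply/eqP/eqP => [e|->].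
  by rewrite -e lexposK.
by rewrite setkey_ix ?nth_index ?setkey_lex36.
Qed.

(** * The thirty three-term relations *)

Definition pair_idx := (nat * nat)%type.

(* The relation [p_i p_i' - p_j p_j' + p_k p_k' = 0] is encoded as
   [((i, i'), (j, j'), (k, k'))]. *)
Definition three_term := (pair_idx * pair_idx * pair_idx)%type.

Definition tpos (a b c : nat) : nat :=
  index (sort leq [:: a.+1; b.+1; c.+1]) lex36.

Arguments tpos : simpl never.
Arguments ix : simpl never.

Definition mkrel (s a b c d : nat) : three_term :=
  ((tpos s a b, tpos s c d), (tpos s a c, tpos s b d),
   (tpos s a d, tpos s b c)).

Definition quad_without (l : seq nat) : seq nat :=
  [seq k <- iota 0 6 | k \notin l].

(* [S = {s}], and [a < b < c < d] are the elements other than [s] and [j]. *)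
Definition rel_of (s j : nat) : three_term :=
  let q := quad_without [:: s; j] in
  mkrel s (nth 0 q 0)%N (nth 0 q 1)%N (nth 0 q 2)%N (nth 0 q 3)%N.

(** In the key [(s, j)], [s] is the element common to all six triples and [j] the element in none of
    them. Fixing either one gives a group of five relations, which is the symmetry behind
    [pf_groups]. *)
Definition relkeys : seq (nat * nat) :=
  [seq (s, j) | s <- iota 0 6, j <- [seq j <- iota 0 6 | j != s]].

Definition rels : seq three_term := [seq rel_of p.1 p.2 | p <- relkeys].

Definition mon (p : pair_idx) : 'X_{1..plN 3 6} :=
  (U_(ix p.1) + U_(ix p.2))%MM.

Definition rel_poly (R : realType) (r : three_term) : {mpoly R[plN 3 6]} :=
  'X_[mon r.1.1] - 'X_[mon r.1.2] + 'X_[mon r.2].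

Lemma rel_polyE (R : realType) (r : three_term) : rel_poly R r =
  'X_(ix r.1.1.1) * 'X_(ix r.1.1.2) - 'X_(ix r.1.2.1) * 'X_(ix r.1.2.2)
  + 'X_(ix r.2.1) * 'X_(ix r.2.2).
Proof. by rewrite /rel_poly /mon !mpolyXD. Qed.

Lemma setkey_triple (a b c : 'I_6) : uniq [:: a; b; c] ->
  setkey ([set a] :|: [set b; c])%SET = sort leq [:: a.+1; b.+1; c.+1].
Proof.
move=> u; apply: setkey_eq.
- rewrite ltn_sorted_uniq_leq sort_uniq (sort_sorted leq_total) andbT.
  by rewrite -[[:: _; _; _]]/(map (fun j : 'I_6 => j.+1) [:: a; b; c])
    map_inj_uniq // => i j [] /ord_inj.
- by rewrite all_sort /= !ltn_ord.
- move=> j; rewrite mem_sort !inE.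
  by rewrite !eqSS -!val_eqE.
Qed.

Lemma tpos_var (R : realType) (a b c : 'I_6) : uniq [:: a; b; c] ->
  pl_var R 3 ([set a] :|: [set b; c])%SET = 'X_(ix (tpos a b c)).
Proof.
move=> u; rewrite pl_var_ix ?setkey_triple //.
move: u; rewrite /= !inE negb_or => /and3P[/andP[ab ac] bc _].
by rewrite cardsU1 !inE negb_or ab ac cards2 bc.
Qed.

Lemma three_term_relationsP (R : realType) (f : {mpoly R[plN 3 6]}) :
  three_term_relations R 3 6 f <-> exists2 r, r \in rels & f = rel_poly R r.
Proof.
split.
  case=> S [a] [b] [c] [d] [cS /and3P[ab bc cd] [aS bS cS' dS] ->].
  have /eqP/cards1P[s Ss] : #|S| = 1%N by lia.
  move: aS bS cS' dS; rewrite {}Ss !inE => aS bS cS' dS.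
  exists (mkrel s a b c d).
    have : all (fun s => all (fun a => all (fun b => all (fun c => all (fun d =>
     [&& (a < b)%N, (b < c)%N, (c < d)%N, a != s, b != s, c != s & d != s]
       ==> (mkrel s a b c d \in rels))
     (iota 0 6)) (iota 0 6)) (iota 0 6)) (iota 0 6)) (iota 0 6)
      by vm_compute.
    have I6 (i : 'I_6) : (i : nat) \in iota 0 6 by rewrite mem_iota /=.
    move=> /allP/(_ _ (I6 s))/allP/(_ _ (I6 a))/allP/(_ _ (I6 b)).
    move=> /allP/(_ _ (I6 c))/allP/(_ _ (I6 d)).
    by rewrite ab bc cd -!val_eqE in aS bS cS' dS *; rewrite aS bS cS' dS.
  have ac := ltn_trans ab bc; have bd := ltn_trans bc cd.
  have ad := ltn_trans ac cd.
  have neq (i j : 'I_6) : (i < j)%N -> i != j by move=> ij; rewrite -val_eqE ltn_eqF.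
  rewrite !tpos_var /= ?inE ?negb_or ?[s == _]eq_sym ?aS ?bS ?cS' ?dS ?neq //.
  by rewrite rel_polyE.
case=> r /mapP[[s j] sj -> ->].
have [s6 [j6 q4]] : (s < 6)%N /\ (j < 6)%N /\
   let q := quad_without [:: s; j] in
   [&& all (fun k => k < 6)%N q, nth 0 q 0 < nth 0 q 1,
      nth 0 q 1 < nth 0 q 2, nth 0 q 2 < nth 0 q 3, s \notin q & size q == 4]%N.
  have : all (fun p => let: (s, j) := p in let q := quad_without [:: s; j] in
     [&& s < 6, j < 6,all (fun k => k < 6)%N q, nth 0 q 0 < nth 0 q 1,
      nth 0 q 1 < nth 0 q 2, nth 0 q 2 < nth 0 q 3, s \notin q & size q == 4]%N)
      relkeys by vm_compute.
  by move/allP/(_ _ sj)=> /and3P[].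
rewrite /rel_of /=; move: q4 => /=; set q := quad_without _.
move: q => [|a [|b [|c [|d [|? ?]]]]] /=; rewrite ?andbF // ?andbT.
case/and5P=> /and4P[a6 b6 c6 d6] ab bc cd; rewrite !inE !negb_or.
case/and4P=> sa sb sc sd.
exists [set Ordinal s6]%SET, (Ordinal a6), (Ordinal b6), (Ordinal c6), (Ordinal d6).
rewrite cards1 /= ab bc cd; split=> //.
  by rewrite !inE -!val_eqE /= ![_ == s]eq_sym.
have ac := ltn_trans ab bc; have bd := ltn_trans bc cd.
have ad := ltn_trans ac cd.
rewrite !tpos_var /= ?inE ?negb_or -?val_eqE /= ?sa ?sb ?sc ?sd ?ltn_eqF //.
by rewrite rel_polyE.
Qed.

(** * Minors of a 3 x 6 matrix *)

Definition det3 (K : comNzRingType) (x : nat -> nat -> K) (a b c : nat) : K :=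
  x 0%N a * (x 1%N b * x 2%N c - x 1%N c * x 2%N b)
  - x 0%N b * (x 1%N a * x 2%N c - x 1%N c * x 2%N a)
  + x 0%N c * (x 1%N a * x 2%N b - x 1%N b * x 2%N a).

Lemma det_mx33 (K : comNzRingType) (x : nat -> nat -> K) :
  \det (\matrix_(i < 3, j < 3) x i j) = det3 x 0 1 2.
Proof.
rewrite (expand_det_row _ ord0) !big_ord_recl big_ord0 /cofactor.
rewrite !(expand_det_row _ ord0) !big_ord_recl !big_ord0 /cofactor.
rewrite !det_mx11 !mxE /= /bump /= /det3.
by rewrite !(add0n, addn0, addn1, add1n, expr0, expr1, exprS); ring.
Qed.

Definition minor (K : comNzRingType) (A : 'M[K]_(3, 6)) (i : 'I_(plN 3 6)) : K :=
  \det (colsub (fun j : 'I_3 =>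
     enum_val (cast_ord (esym (eqP (valP (pl_index i)))) j)) A).

Definition lexcol (k j : nat) : nat := (nth 0 (nth [::] lex36 k) j)%N.-1.

Definition lexminor (K : comNzRingType) (x : nat -> nat -> K) (k : nat) : K :=
  det3 x (lexcol k 0) (lexcol k 1) (lexcol k 2).

Lemma minorE (K : comNzRingType) (A : 'M[K]_(3, 6)) k : (k < 20)%N ->
  minor A (ix k) = lexminor (fun r j => A (inord r) (inord j)) k.
Proof.
move=> k20; rewrite -[RHS](det_mx33 (fun r j => A (inord r) (inord (lexcol k j)))).
congr (\det _); apply/matrixP => i j; rewrite !mxE inord_val; congr (A i _).
rewrite (enum_val_nth ord0) /= /lexcol -setkey_ix //.
set s := val _; have szs : size (enum s) = 3%N.
  by rewrite -cardE; apply/eqP/(valP (pl_index (ix k))).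
rewrite /setkey (nth_map ord0) ?szs //=; first by rewrite inord_val.
Qed.

Definition rel_eval (K : comNzRingType) (p : nat -> K) (r : three_term) : K :=
  p r.1.1.1 * p r.1.1.2 - p r.1.2.1 * p r.1.2.2 + p r.2.1 * p r.2.2.

Definition rels_explicit : seq three_term := Eval vm_compute in rels.

Lemma relsE : rels = rels_explicit.
Proof. by vm_compute. Qed.

Lemma lexminor_rel (K : comNzRingType) (x : nat -> nat -> K) r :
  r \in rels -> rel_eval (lexminor x) r = 0.
Proof.
rewrite relsE /rels_explicit !inE.
by do !(case/orP=> [/eqP->|]); try move/eqP=> ->;
  rewrite /rel_eval /lexminor /det3 /lexcol /=; ring.
Qed.

Lemma rel_poly_pluecker (R : realType) r :
  r \in rels -> pluecker_ideal R 3 6 (rel_poly R r).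
Proof.
move=> rr; rewrite /pluecker_ideal /= rel_polyE.
rewrite rmorphD rmorphB /= !rmorphM /= !comp_mpolyXU.
have lt20 : [&& r.1.1.1 < 20, r.1.1.2 < 20, r.1.2.1 < 20, r.1.2.2 < 20,
    r.2.1 < 20 & r.2.2 < 20]%N.
  have : all (fun r => [&& r.1.1.1 < 20, r.1.1.2 < 20, r.1.2.1 < 20,
    r.1.2.2 < 20, r.2.1 < 20 & r.2.2 < 20]%N) rels by vm_compute.
  by move/allP/(_ _ rr).
rewrite -!tnth_nth !tnth_mktuple.
case/and5P: lt20 => ? ? ? ? /andP[? ?].
have E i : generic_minor R i = minor (generic_mx R 3 6) i by [].
by rewrite !E !minorE //; exact: (lexminor_rel _ rr).
Qed.

Lemma meval_pluecker (R : realType) (f : {mpoly R[plN 3 6]}) (A : 'M[R]_(3, 6)) :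
  pluecker_ideal R 3 6 f -> f.@[minor A] = 0.
Proof.
move=> /(congr1 (meval (fun t => mxvec A 0 t))); rewrite meval0 comp_mpoly_meval.
move=> <-; apply: meval_eq => i; rewrite tnth_mktuple /generic_minor /minor.
rewrite -det_map_mx; congr (\det _); apply/matrixP => a b.
by rewrite !mxE /= mevalXU mxvecE.
Qed.

Lemma solve_rel (F : fieldType) (a b c d : F) :
  a != 0 -> a * b - c + d = 0 -> b = (c - d) / a.
Proof.
move=> a0 e; apply: (mulfI a0); rewrite mulrCA divff // mulr1.
by apply/eqP; rewrite -subr_eq0 opprB addrA addrAC e.
Qed.

(** The first three columns of the matrix form diag(1, 1, p_123). The ten minors that share at least
    two columns with 123 are then right by construction, and the relations express the other ten
    through these. *)
Lemma realize (F : fieldType) (p : nat -> F) :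
  (forall k, (k < 20)%N -> p k != 0) ->
  (forall r, r \in rels -> rel_eval p r = 0) ->
  exists A : 'M[F]_(3, 6), forall k, (k < 20)%N -> minor A (ix k) = p k.
Proof.
move=> p0 pr; pose x (r j : nat) : F := nth 0 (nth [::]
  [:: [:: 1; 0; 0; p 10%N / p 0%N; p 11%N / p 0%N; p 12%N / p 0%N];
      [:: 0; 1; 0; - p 4%N / p 0%N; - p 5%N / p 0%N; - p 6%N / p 0%N];
      [:: 0; 0; p 0%N; p 1%N; p 2%N; p 3%N]] r) j.
exists (\matrix_(i, j) x i j) => k k20; rewrite minorE //.
have -> : lexminor (fun r j => (\matrix_(i < 3, j < 6) x i j) (inord r) (inord j)) k
   = lexminor x k.
  have : all (fun j => lexcol k j < 6)%N (iota 0 3).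
    have : all (fun k => all (fun j => lexcol k j < 6)%N (iota 0 3)) (iota 0 20).
      by vm_compute.
    by move/allP/(_ k); rewrite mem_iota k20; apply.
  case/and4P=> c0 c1 c2 _; rewrite /lexminor /det3 !mxE.
  by rewrite (inordK c0) (inordK c1) (inordK c2) !inordK.
have p00 := p0 0%N isT; have p10 := p0 1%N isT.
have R1 i j a b c d : ((i, j), (a, b), (c, d)) \in rels -> p i != 0 ->
    p j = (p a * p b - p c * p d) / p i.
  by move=> rr pi0; apply: solve_rel => //; exact: (pr _ rr).
have e7 := R1 0 7 1 5 2 4 isT p00; have e8 := R1 0 8 1 6 3 4 isT p00.
have e9 := R1 0 9 2 6 3 5 isT p00.
have e13 := R1 0 13 1 11 2 10 isT p00; have e14 := R1 0 14 1 12 3 10 isT p00.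
have e15 := R1 0 15 2 12 3 11 isT p00.
have e16 := R1 0 16 4 11 5 10 isT p00; have e17 := R1 0 17 4 12 6 10 isT p00.
have e18 := R1 0 18 5 12 6 11 isT p00.
(* The sets 123 and 456 are disjoint, so no three-term relation contains the product p_123 p_456;
   p_456 is obtained by dividing by p_124 instead. *)
have e19 := R1 1 19 7 14 8 13 isT p10.
do 20?[case: k k20 => [_|k k20];
  first by rewrite /lexminor /det3 /lexcol /= /x /=
   ?(e19, e18, e17, e16, e15, e14, e13, e9, e8, e7); field; rewrite ?p00 ?p10].
by [].
Qed.

Delimit Scope Z_scope with ZZ.

(** * Cones with integer generators *)

Notation zvec := (seq Z).

(* [(t, u)] stands for the linear form [x_u1 + x_u2 - x_t1 - x_t2]. *)
Notation cond := (pair_idx * pair_idx)%type.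

(* Unlike [all] and [has], whose [&&] and [||] are strict for [vm_compute],
   these stop at the first witness. *)
Fixpoint allf (T : Type) (p : T -> bool) (s : seq T) : bool :=
  if s is x :: s' then if p x then allf p s' else false else true.

Fixpoint hasf (T : Type) (p : T -> bool) (s : seq T) : bool :=
  if s is x :: s' then if p x then true else hasf p s' else false.

Fixpoint eqz (u v : zvec) : bool :=
  match u, v with
  | [::], [::] => true
  | x :: u', y :: v' => if (x =? y)%ZZ then eqz u' v' else false
  | _, _ => false
  end.

Lemma allfE (T : Type) (p : T -> bool) s : allf p s = all p s.
Proof. by elim: s => //= x s ->; case: (p x). Qed.

Lemma hasfE (T : Type) (p : T -> bool) s : hasf p s = has p s.
Proof. by elim: s => //= x s ->; case: (p x). Qed.

Lemma eqzE u v : eqz u v = (u == v).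
Proof.
elim: u v => [|x u IH] [|y v] //=; rewrite IH eqseq_cons.
by case: Z.eqb_spec => [->|/eqP/negPf->]; rewrite ?eqxx.
Qed.

(** Missing entries count as 0, in agreement with the default of [nth]; in particular [[::]] is the
    zero vector. *)
Fixpoint zlc (a : Z) (u : zvec) (b : Z) (v : zvec) : zvec :=
  match u, v with
  | [::], _ => [seq (b * y)%ZZ | y <- v]
  | _, [::] => [seq (a * y)%ZZ | y <- u]
  | x :: u', y :: v' => (a * x + b * y)%ZZ :: zlc a u' b v'
  end.

Definition zval (c : cond) (v : zvec) : Z :=
  (nth 0 v c.2.1 + nth 0 v c.2.2 - nth 0 v c.1.1 - nth 0 v c.1.2)%ZZ.

(** A pair [(B, V)] stands for the sum of the linear span of [B] and the cone generated by [V]. *)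
Definition gencone := (seq zvec * seq zvec)%type.

Definition proj (h : cond) (b v : zvec) : zvec :=
  zlc (zval h b) v (- zval h v)%ZZ b.

(** The vector taken out of [B] is normalised to [h > 0], so that [cut_ge] can use it as a new
    generator. *)
Definition pivot (h : cond) (B : seq zvec) : option (zvec * seq zvec) :=
  let i := find (fun b => ~~ (zval h b =? 0)%ZZ) B in
  if (i < size B)%N then
    let b := nth [::] B i in
    let b' := if (zval h b <? 0)%ZZ then zlc (-1)%ZZ b 0%ZZ [::] else b in
    Some (b', [seq proj h b' v | v <- take i B ++ drop i.+1 B])
  else None.

(* Bisecting an edge [u v] at its intersection with the hyperplane [h = 0]
   splits the cone into two cones that are still simplicial. *)
Fixpoint refine (fuel : nat) (h : cond) (V : seq zvec) : seq (seq zvec) :=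
  if fuel is n.+1 then
    let i := find (fun v => (0 <? zval h v)%ZZ) V in
    let j := find (fun v => (zval h v <? 0)%ZZ) V in
    if (if (i < size V)%N then (j < size V)%N else false) then
      let u := nth [::] V i in
      let v := nth [::] V j in
      let w := zlc (zval h u) v (- zval h v)%ZZ u in
      refine n h (w :: [seq z <- V | ~~ eqz z u]) ++
      refine n h (w :: [seq z <- V | ~~ eqz z v])
    else [:: V]
  else [:: V].

Definition refine_fuel := 20%N.

Definition zero_part (h : cond) (V : seq zvec) : seq zvec :=
  [seq v <- V | (zval h v =? 0)%ZZ].

(** If all generators lie on one side of the hyperplane, it meets the cone in the face of the
    generators lying on it. If [refine] ran out of fuel and signs are mixed, [W] is kept whole: the
    result still covers, and a cone that is too large is rejected by the generator test of
    [check_cells]. *)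
Definition cut_eq (h : cond) (c : gencone) : seq gencone :=
  if pivot h c.1 is Some (b, B) then [:: (B, [seq proj h b v | v <- c.2])]
  else [seq (c.1, if allf (fun v => 0 <=? zval h v)%ZZ W then zero_part h W
                  else if allf (fun v => zval h v <=? 0)%ZZ W
                  then zero_part h W else W)
       | W <- refine refine_fuel h c.2].

Definition cut_ge (h : cond) (c : gencone) : seq gencone :=
  if pivot h c.1 is Some (b, B) then [:: (B, b :: [seq proj h b v | v <- c.2])]
  else [seq (c.1, if allf (fun v => zval h v <=? 0)%ZZ W
                  then zero_part h W else W)
       | W <- refine refine_fuel h c.2].

Definition sub_vecs (V W : seq zvec) : bool :=
  allf (fun v => hasf (eqz v) W) V.

Lemma sub_vecsP V W : reflect {subset V <= W} (sub_vecs V W).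
Proof.
rewrite /sub_vecs allfE; apply: (iffP allP) => h v vV.
  have := h _ vV; rewrite hasfE => /hasP[w wW]; rewrite eqzE => /eqP-> //.
by rewrite hasfE; apply/hasP; exists v; rewrite ?eqzE ?h.
Qed.

Fixpoint insert_cones (acc cs : seq gencone) : seq gencone :=
  if cs is c :: cs' then
    insert_cones (if hasf (fun d => if sub_vecs c.2 d.2 then sub_vecs c.1 d.1
                                  else false) acc
                  then acc else c :: acc) cs'
  else acc.

(** One pass removes a cone contained in an earlier one and reverses the list; the second pass
    therefore removes those contained in a later one. *)
Definition prune (cs : seq gencone) : seq gencone :=
  insert_cones [::] (insert_cones [::] cs).

(* From here on, a relation [((t, t'), (u, u'), (v, v'))] is read as the tropical
   equation [x_t + x_t' = min (x_u + x_u') (x_v + x_v')]. *)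
Definition cond_u (r : three_term) : cond := (r.1.1, r.1.2).
Definition cond_v (r : three_term) : cond := (r.1.1, r.2).

Definition cut_rel (cs : seq gencone) (r : three_term) : seq gencone :=
  prune (flatten [seq flatten (map (cut_ge (cond_v r)) (cut_eq (cond_u r) c))
                   ++ flatten (map (cut_ge (cond_u r)) (cut_eq (cond_v r) c))
                 | c <- cs]).

Definition zunit (k : nat) : zvec :=
  [seq if i == k then 1%ZZ else 0%ZZ | i <- iota 0 20].

Definition zfull : gencone := ([seq zunit k | k <- iota 0 20], [::]).

Definition cover (rs : seq three_term) : seq gencone :=
  foldl cut_rel [:: zfull] rs.

(** A form that is nonnegative on [V] vanishes at a nonnegative combination exactly when it vanishes
    on every generator with positive coefficient. A point thus has the same ties as the plain sum of
    the generators it uses, and the subset sums exhaust all tie patterns. *)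
Fixpoint subsums (V : seq zvec) : seq zvec :=
  if V is v :: V' then
    let s := subsums V' in s ++ [seq zlc 1%ZZ v 1%ZZ w | w <- s]
  else [:: [::]].

Lemma nth_zlc a u b v k :
  nth 0%ZZ (zlc a u b v) k = (a * nth 0%ZZ u k + b * nth 0%ZZ v k)%ZZ.
Proof.
have nth0 d (w : zvec) i : nth 0%ZZ [seq (d * z)%ZZ | z <- w] i = (d * nth 0%ZZ w i)%ZZ.
  elim: w i => [|y w IH] [|i] //=; by rewrite Z.mul_0_r.
elim: u v k => [|x u IH] v k.
  rewrite [zlc _ _ _ _]/= nth0 nth_nil; lia.
case: v => [|y v] /=; first by rewrite -/(map _ (x :: u)) nth0 nth_nil; lia.
by case: k => [|k] //=.
Qed.

Lemma zval_zlcD c v w : zval c (zlc 1%ZZ v 1%ZZ w) = (zval c v + zval c w)%ZZ.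
Proof. by rewrite /zval !nth_zlc; lia. Qed.

Lemma leZ0D (a b : Z) : (0 <=? a)%ZZ -> (0 <=? b)%ZZ -> (0 <=? a + b)%ZZ.
Proof. lia. Qed.

Lemma eqZ0D (a b : Z) : (0 <=? a)%ZZ -> (0 <=? b)%ZZ ->
  ((a + b)%ZZ == 0%ZZ) = (a == 0%ZZ) && (b == 0%ZZ).
Proof.
move=> a0 b0; apply/eqP/andP => [e|[/eqP-> /eqP->] //].
by split; apply/eqP; lia.
Qed.

(** * Real cones with integer generators, and soundness of the cuts *)

Section Cones.

Variable R : realType.
Notation E := 'rV[R]_(plN 3 6).
Implicit Types (x y : E) (c : cond) (B V W : seq zvec).

Definition zr (z : Z) : R := (int_of_Z z)%:~R.

Lemma zr0 : zr 0%ZZ = 0. Proof. by []. Qed.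
Lemma zr1 : zr 1%ZZ = 1. Proof. by []. Qed.
Lemma zrD a b : zr (a + b)%ZZ = zr a + zr b.
Proof.
rewrite /zr -intrD; congr _%:~R.
by apply: (can_inj Z_of_intK); rewrite int_of_ZK; lia.
Qed.
Lemma zrM a b : zr (a * b)%ZZ = zr a * zr b.
Proof.
rewrite /zr -intrM; congr _%:~R.
by apply: (can_inj Z_of_intK); rewrite int_of_ZK; lia.
Qed.
Lemma zrN a : zr (- a)%ZZ = - zr a.
Proof.
rewrite /zr -mulrNz; congr _%:~R.
by apply: (can_inj Z_of_intK); rewrite int_of_ZK; lia.
Qed.
Lemma zrB a b : zr (a - b)%ZZ = zr a - zr b.
Proof. by rewrite -zrN -zrD. Qed.
Lemma zr_ge0 a : (0 <= zr a) = (0 <=? a)%ZZ.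
Proof. by rewrite /zr ler0z; apply/idP/idP; lia. Qed.
Lemma zr_gt0 a : (0 < zr a) = (0 <? a)%ZZ.
Proof. by rewrite /zr ltr0z; apply/idP/idP; lia. Qed.
Lemma zr_ge1 a : (1 <= zr a) = (0 <? a)%ZZ.
Proof. by rewrite /zr -[1]/(1%:~R) ler_int; apply/idP/idP; lia. Qed.
Lemma zr_eq0 a : (zr a == 0) = (a == 0%ZZ).
Proof. by rewrite /zr intr_eq0; apply/eqP/eqP; lia. Qed.

Definition vec (v : zvec) : E := \row_i zr (nth 0%ZZ v (lexpos i)).

Lemma vecE v k : (k < 20)%N -> vec v 0 (ix k) = zr (nth 0%ZZ v k).
Proof. by move=> k20; rewrite mxE ixK. Qed.

Lemma vec_zlc a u b v : vec (zlc a u b v) = zr a *: vec u + zr b *: vec v.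
Proof. by apply/rowP => i; rewrite !mxE nth_zlc zrD !zrM. Qed.

Definition form c (x : E) : R :=
  x 0 (ix c.2.1) + x 0 (ix c.2.2) - x 0 (ix c.1.1) - x 0 (ix c.1.2).

Lemma form_is_scalar c : scalar (form c).
Proof. by move=> a x y; rewrite /form !mxE; ring. Qed.

HB.instance Definition _ c :=
  GRing.isLinear.Build R E R _ (form c) (form_is_scalar c).

Lemma formD c x y : form c (x + y) = form c x + form c y.
Proof. exact: linearD. Qed.
Lemma formB c x y : form c (x - y) = form c x - form c y.
Proof. exact: linearB. Qed.
Lemma formZ c (a : R) x : form c (a *: x) = a * form c x.
Proof. exact: linearZ. Qed.

Definition cond_lt20 c : bool :=
  [&& c.1.1 < 20, c.1.2 < 20, c.2.1 < 20 & c.2.2 < 20]%N.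

Lemma form_vec c v : cond_lt20 c -> form c (vec v) = zr (zval c v).
Proof. by case/and4P=> ? ? ? ?; rewrite /form !vecE // /zval !zrB zrD. Qed.

Fixpoint incone B V x : Prop :=
  if V is v :: V' then exists2 l : R, 0 <= l & incone B V' (x - l *: vec v)
  else x \in <<map vec B>>%VS.

Lemma incone_span B V x : x \in <<map vec B>>%VS -> incone B V x.
Proof.
elim: V x => [|v V IH] x xB //=; exists 0 => //.
by rewrite scale0r subr0; apply: IH.
Qed.

Lemma inconeD B V x y : incone B V x -> incone B V y -> incone B V (x + y).
Proof.
elim: V x y => [|v V IH] x y /=; first exact: memvD.
case=> l l0 xV [m m0 yV]; exists (l + m); first exact: addr_ge0.
by rewrite scalerDl opprD addrACA; apply: IH.
Qed.

Lemma inconeZ B V x (a : R) : 0 <= a -> incone B V x -> incone B V (a *: x).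
Proof.
move=> a0; elim: V x => [|v V IH] x /=; first exact: memvZ.
case=> l l0 xV; exists (a * l); first exact: mulr_ge0.
by rewrite -scalerA -scalerBr; apply: IH.
Qed.

Lemma incone_mem B V v : v \in V -> incone B V (vec v).
Proof.
elim: V => [|u V IH] //=; rewrite inE => /orP[/eqP->|vV].
  by exists 1 => //; rewrite scale1r subrr; apply: incone_span; exact: mem0v.
by exists 0 => //; rewrite scale0r subr0; apply: IH.
Qed.

Lemma incone_sub B V W x : {subset V <= W} -> incone B V x -> incone B W x.
Proof.
elim: V x => [|v V IH] x sVW /=; first exact: incone_span.
case=> l l0 xV; rewrite -(subrK (l *: vec v) x); apply: inconeD.
  by apply: IH xV => z zV; apply: sVW; rewrite inE zV orbT.
by apply: inconeZ l0 _; apply: incone_mem; apply: sVW; rewrite inE eqxx.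
Qed.

Lemma incone_subl B B' V x : {subset B <= B'} -> incone B V x -> incone B' V x.
Proof.
move=> sB; elim: V x => [|v V IH] x /=; last first.
  by case=> l l0 xV; exists l => //; apply: IH.
apply: subvP; apply: sub_span => _ /mapP[b bB ->]; apply: map_f; exact: sB.
Qed.

Lemma span_form B c x : cond_lt20 c ->
  all (fun b => zval c b == 0%ZZ) B -> x \in <<map vec B>>%VS -> form c x = 0.
Proof.
move=> c20 Bc xB; rewrite (coord_span (X := in_tuple (map vec B)) xB) linear_sum.
rewrite big1 // => i _ /=; rewrite formZ.
have iB : (i < size B)%N by rewrite -(size_map vec) ltn_ord.
rewrite (nth_map [::]) // form_vec // (eqP (allP Bc _ (mem_nth _ iB))).
by rewrite zr0 mulr0.
Qed.

Definition projR c b x : E := zr (zval c b) *: x - form c x *: vec b.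

Lemma projR_is_linear c b : linear (projR c b).
Proof.
move=> a x y; rewrite /projR form_is_scalar; apply/rowP => i; rewrite !mxE; ring.
Qed.

HB.instance Definition _ c b :=
  GRing.isLinear.Build R E E _ (projR c b) (projR_is_linear c b).

Lemma vec_proj c b v : cond_lt20 c -> vec (proj c b v) = projR c b (vec v).
Proof. by move=> c20; rewrite /proj vec_zlc zrN scaleNr /projR form_vec. Qed.

Lemma projR_incone B V B' c b x : cond_lt20 c ->
  {in B, forall v, projR c b (vec v) \in <<map vec B'>>%VS} ->
  incone B V x -> incone B' [seq proj c b v | v <- V] (projR c b x).
Proof.
move=> c20 BB'; elim: V x => [|v V IH] x /=.
  move=> xB; rewrite (coord_span (X := in_tuple (map vec B)) xB) linear_sum.
  apply: memv_suml => i _; rewrite linearZ /=; apply: memvZ.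
  have iB : (i < size B)%N by rewrite -(size_map vec) ltn_ord.
  by rewrite (nth_map [::]) //; apply: BB'; apply: mem_nth.
case=> l l0 xV; exists l => //; rewrite vec_proj // -linearZ -linearB /=.
exact: IH.
Qed.

Lemma pivot_Some c B b B' : cond_lt20 c -> pivot c B = Some (b, B') ->
  0 < zr (zval c b) /\
  {in B, forall v, projR c b (vec v) \in <<map vec B'>>%VS}.
Proof.
move=> c20; rewrite /pivot; set i := find _ _; case: ifP => // iB [<- <-].
have /eqP hb : zval c (nth [::] B i) != 0%ZZ.
  by apply: (@nth_find _ _ (fun b => ~~ (zval c b =? 0)%ZZ)); rewrite has_find.
set b' := if _ then _ else _.
have [b'0 vb'] : 0 < zr (zval c b') /\ exists a, vec (nth [::] B i) = a *: vec b'.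
  rewrite -(form_vec _ c20) /b'; case: ifP => hb0.
    rewrite vec_zlc zr0 scale0r addr0 formZ form_vec // -zrM zr_gt0.
    by split; [lia|exists (-1); rewrite scalerA mulN1r /zr /= opprK scale1r].
  by rewrite form_vec // zr_gt0; split; [lia|exists 1; rewrite scale1r].
split=> // v vB; set D := take _ _ ++ _.
have [->|vD] : v = nth [::] B i \/ v \in D.
  move: vB; rewrite -{1}(cat_take_drop i B) (drop_nth [::] iB) mem_cat inE.
  by rewrite mem_cat => /or3P[->|/eqP->|->]; rewrite ?orbT; auto.
  case: vb' => a ->; rewrite /projR formZ form_vec // scalerA mulrC subrr.
  exact: mem0v.
by rewrite -vec_proj //; apply: memv_span; do 2!apply: map_f.
Qed.

Lemma pivot_None c B : pivot c B = None -> all (fun b => zval c b == 0%ZZ) B.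
Proof.
rewrite /pivot -has_find; case: ifP => // /negbT; rewrite -all_predC.
by move=> h _; apply: sub_all h => b /=; rewrite negbK => /Z.eqb_spec->.
Qed.

(** In a part [a u + b v] of [x], multiples of [w] are taken out until one of [u], [v] is exhausted;
    comparing [a / n] with [b / p] tells which one. *)
Lemma incone_split B V u v x (p n : R) w : u \in V -> v \in V -> u != v ->
  0 < p -> 0 < n -> vec w = p *: vec v + n *: vec u ->
  incone B V x -> incone B (w :: [seq z <- V | z != u]) x \/
                  incone B (w :: [seq z <- V | z != v]) x.
Proof.
move=> uV vV uv p0 n0 ew xV.
have {}xV : incone B (u :: v :: [seq z <- V | (z != u) && (z != v)]) x.
  apply: incone_sub xV => z zV; rewrite !inE mem_filter zV andbT.
  by case: eqP => //=; case: eqP.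
case: xV => a a0 [b b0 xV].
set W := filter _ V in xV; set y := x - _ - _ in xV.
rewrite -/(incone B W y) in xV.
have [sWu sWv] : {subset W <= [seq z <- V | z != u]} /\
    {subset W <= [seq z <- V | z != v]}.
  by split=> z; rewrite !mem_filter => /andP[/andP[zu zv] ->]; rewrite ?zu ?zv.
have ex : x = y + (a *: vec u + b *: vec v).
  by rewrite /y [_ *: vec u + _]addrC addrA !subrK.
have [ab|ba] := leP (a * p) (b * n).
  left; exists (a / n); first by rewrite divr_ge0 // ltW.
  have -> : x - a / n *: vec w = y + (b - a * p / n) *: vec v.
    rewrite ex ew; apply/rowP => i; rewrite !mxE; field.
    by rewrite gt_eqF.
  apply: inconeD; first exact: incone_sub xV.
  apply: inconeZ; last by apply: incone_mem; rewrite mem_filter eq_sym uv.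
  by rewrite subr_ge0 ler_pdivrMr.
right; exists (b / p); first by rewrite divr_ge0 // ltW.
have -> : x - b / p *: vec w = y + (a - b * n / p) *: vec u.
  rewrite ex ew; apply/rowP => i; rewrite !mxE; field.
  by rewrite gt_eqF.
apply: inconeD; first exact: incone_sub xV.
apply: inconeZ; last by apply: incone_mem; rewrite mem_filter uv.
by rewrite subr_ge0 ler_pdivrMr // ltW.
Qed.

Lemma refine_sound fuel c B V x : cond_lt20 c -> incone B V x ->
  exists2 W, W \in refine fuel c V & incone B W x.
Proof.
move=> c20; elim: fuel V => [|n IH] V xV /=; first by exists V; rewrite ?inE.
case: (ltnP (find _ V) (size V)) => iV; last by exists V; rewrite ?inE.
case: ifP => [jV|_]; last by exists V; rewrite ?inE.
set u := nth _ _ _; set v := nth _ _ (find (fun v => (zval c v <? 0)%ZZ) V).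
have hu : (0 <? zval c u)%ZZ.
  by apply: (@nth_find _ _ (fun v => (0 <? zval c v)%ZZ)); rewrite has_find.
have hv : (zval c v <? 0)%ZZ.
  by apply: (@nth_find _ _ (fun v => (zval c v <? 0)%ZZ)); rewrite has_find.
have E z : [seq y <- V | ~~ eqz y z] = [seq y <- V | y != z].
  by apply: eq_filter => y; rewrite eqzE.
rewrite !E {E}; have uv : u != v by apply/eqP => e; move: hv; rewrite -e; lia.
case: (@incone_split B V u v x (zr (zval c u)) (zr (- zval c v)%ZZ)
  (zlc (zval c u) v (- zval c v)%ZZ u)) => //.
- exact: mem_nth.
- exact: mem_nth.
- by rewrite zr_gt0.
- by rewrite zr_gt0; lia.
- exact: vec_zlc.
- by move/IH=> [W WW xW]; exists W; rewrite // mem_cat WW.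
- by move/IH=> [W WW xW]; exists W; rewrite // mem_cat WW orbT.
Qed.

Arguments refine : simpl never.

(** All contributions of generators to [s * form c x] are nonnegative and their sum is at most 0, so
    each is 0. The factor [s], later 1 or -1, treats both sides of the hyperplane at once. *)
Lemma zero_part_sound c B V x (s : Z) : cond_lt20 c -> (s != 0)%ZZ ->
  all (fun b => zval c b == 0%ZZ) B -> all (fun v => 0 <=? s * zval c v)%ZZ V ->
  zr s * form c x <= 0 -> incone B V x -> incone B (zero_part c V) x.
Proof.
move=> c20 s0 Bc; elim: V x => [|v V IH] x //= /andP[v0 V0] sx [l l0 xV].
have yge0 : forall y, incone B V y -> 0 <= zr s * form c y.
  elim: V V0 {IH xV} => [|u V IH] /= V0 y.
    by move=> yB; rewrite (@span_form B c) ?mulr0.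
  case/andP: V0 => u0 V0 [m m0 /(IH V0)].
  rewrite formB formZ form_vec // mulrBr subr_ge0; apply: le_trans.
  by rewrite mulrCA mulr_ge0 // -zrM zr_ge0.
have := yge0 _ xV; rewrite formB formZ form_vec // mulrBr subr_ge0.
move=> le1; have lv0 : l * (zr s * zr (zval c v)) = 0.
  apply/eqP; rewrite eq_le mulrCA (le_trans le1 sx) /=.
  by rewrite mulrCA mulr_ge0 // -zrM zr_ge0.
have sx' : zr s * form c (x - l *: vec v) <= 0.
  by rewrite formB formZ form_vec // mulrBr mulrCA lv0 subr0.
case: ifP => [_|hv]; first by exists l => //; apply: IH.
move/eqP: lv0; rewrite mulf_eq0 -zrM zr_eq0 => /orP[/eqP l00|].
  by move: xV sx'; rewrite l00 scale0r subr0 => xV sx'; apply: IH.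
by move/eqP=> e; move/eqP: s0 => s0; nia.
Qed.

Definition in_cones (cs : seq gencone) x : Prop :=
  exists2 c : gencone, c \in cs & incone c.1 c.2 x.

Lemma pivot_incone h B V b B' x : cond_lt20 h -> pivot h B = Some (b, B') ->
  0 <= form h x -> incone B V x ->
  exists2 y, incone B' [seq proj h b v | v <- V] y &
    exists2 l : R, 0 <= l /\ (form h x = 0 -> l = 0) & x = y + l *: vec b.
Proof.
move=> h20 pB hx xV; have [b0 BB'] := pivot_Some h20 pB.
exists ((zr (zval h b))^-1 *: projR h b x).
  by apply: inconeZ; [rewrite invr_ge0 ltW|exact: projR_incone xV].
exists (form h x / zr (zval h b)).
  split; first by rewrite divr_ge0 // ltW.
  by move=> ->; rewrite mul0r.
rewrite /projR scalerBr !scalerA mulVf ?gt_eqF // scale1r [_^-1 * _]mulrC.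
by rewrite subrK.
Qed.

Lemma cut_eq_sound h (c : gencone) x : cond_lt20 h -> form h x = 0 ->
  incone c.1 c.2 x -> in_cones (cut_eq h c) x.
Proof.
case: c => B V h20 hx /= xV; rewrite /in_cones /cut_eq /=.
case pB: (pivot h B) => [[b B']|].
  have [|y yV [l [_ l0] ->]] := pivot_incone h20 pB _ xV; first by rewrite hx.
  exists (B', [seq proj h b v | v <- V]); first by rewrite inE.
  by rewrite l0 // scale0r addr0.
have Bh := pivot_None pB.
have [W WV xW] := refine_sound refine_fuel h20 xV.
eexists; first by apply: map_f; exact: WV.
rewrite /= !allfE; case: ifP => W0; last case: ifP => // {}W0.
  apply: (@zero_part_sound h B W x 1%ZZ) => //; last by rewrite hx mulr0.
  by apply: sub_all W0 => v; lia.
apply: (@zero_part_sound h B W x (-1)%ZZ) => //; last by rewrite hx mulr0.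
by apply: sub_all W0 => v; lia.
Qed.

Lemma cut_ge_sound h (c : gencone) x : cond_lt20 h -> 0 <= form h x ->
  incone c.1 c.2 x -> in_cones (cut_ge h c) x.
Proof.
case: c => B V h20 hx /= xV; rewrite /in_cones /cut_ge /=.
case pB: (pivot h B) => [[b B']|].
  have [y yV [l [l0 _] ->]] := pivot_incone h20 pB hx xV.
  exists (B', b :: [seq proj h b v | v <- V]); first by rewrite inE.
  by exists l => //; rewrite addrK.
have Bh := pivot_None pB.
have [W WV xW] := refine_sound refine_fuel h20 xV.
eexists; first by apply: map_f; exact: WV.
rewrite /= allfE; case: ifP => // W0.
apply: (@zero_part_sound h B W x (-1)%ZZ) => //.
  by apply: sub_all W0 => v; lia.
by rewrite mulN1r oppr_le0.
Qed.

Lemma insert_cones_sound acc cs x :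
  in_cones (acc ++ cs) x -> in_cones (insert_cones acc cs) x.
Proof.
elim: cs acc => [|c cs IH] acc; first by rewrite cats0.
move=> [d]; rewrite mem_cat inE => dd xd; apply: IH.
rewrite hasfE; case: ifP => [/hasP[e eA]|_]; last first.
  by exists d => //; rewrite mem_cat inE; case/or3P: dd => ->; rewrite ?orbT.
case: ifP => // /sub_vecsP cV /sub_vecsP cB.
case/or3P: dd => [dA|/eqP dc|dc].
- by exists d; rewrite // mem_cat dA.
- exists e; first by rewrite mem_cat eA.
  by apply: incone_subl cB _; apply: incone_sub cV _; rewrite -dc.
- by exists d; rewrite // mem_cat dc orbT.
Qed.

Lemma prune_sound cs x : in_cones cs x -> in_cones (prune cs) x.
Proof. by move=> h; do 2!apply: (@insert_cones_sound [::]). Qed.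

Definition trop_rel (r : three_term) x : Prop :=
  [/\ 0 <= form (cond_u r) x, 0 <= form (cond_v r) x &
      form (cond_u r) x = 0 \/ form (cond_v r) x = 0].

Definition rel_lt20 (r : three_term) : bool :=
  cond_lt20 (cond_u r) && cond_lt20 (cond_v r).

Lemma in_cones_flatten (cs : seq gencone) (f : gencone -> seq gencone)
    (c : gencone) x :
  c \in cs -> in_cones (f c) x -> in_cones (flatten (map f cs)) x.
Proof.
move=> ccs [d dc xd]; exists d => //; apply/flattenP; exists (f c) => //.
exact: map_f.
Qed.

Lemma cut_rel_sound r cs x : rel_lt20 r -> trop_rel r x ->
  in_cones cs x -> in_cones (cut_rel cs r) x.
Proof.
case/andP=> u20 v20 [u0 v0 uv] [c ccs xc]; apply: prune_sound.
apply: in_cones_flatten ccs _; case: uv => e0.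
  have [d dc xd] := cut_eq_sound u20 e0 xc.
  have [e ee xe] := in_cones_flatten dc (cut_ge_sound v20 v0 xd).
  by exists e; rewrite // mem_cat ee.
have [d dc xd] := cut_eq_sound v20 e0 xc.
have [e ee xe] := in_cones_flatten dc (cut_ge_sound u20 u0 xd).
by exists e; rewrite // mem_cat ee orbT.
Qed.

Lemma vec_zunit k : (k < 20)%N -> vec (zunit k) = delta_mx 0 (ix k).
Proof.
move=> k20; apply/rowP => i; rewrite !mxE eqxx /=.
rewrite (nth_map 0%N) ?size_iota ?lexpos_lt // nth_iota ?lexpos_lt // add0n.
by rewrite -[i in RHS]lexposK ix_inj ?lexpos_lt //; case: eqP.
Qed.

Lemma zfull_span x : x \in <<map vec zfull.1>>%VS.
Proof.
rewrite (row_sum_delta x); apply: memv_suml => i _; apply: memvZ.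
apply: memv_span; rewrite -(lexposK i) -vec_zunit ?lexpos_lt //.
by do 2!apply: map_f; rewrite mem_iota lexpos_lt.
Qed.

Lemma cover_sound rs x : all rel_lt20 rs -> {in rs, forall r, trop_rel r x} ->
  in_cones (cover rs) x.
Proof.
rewrite /cover; have : in_cones [:: zfull] x.
  by exists zfull; rewrite ?inE //; exact: zfull_span.
elim: rs [:: zfull] => [|r rs IH] cs xcs //= /andP[r20 rs20] rx.
apply: IH => //; last by move=> s ss; apply: rx; rewrite inE ss orbT.
by apply: cut_rel_sound => //; apply: rx; rewrite inE eqxx.
Qed.

Lemma subsums_sound (cs : seq cond) B V x : all cond_lt20 cs ->
  all (fun b => all (fun c => zval c b == 0%ZZ) cs) B ->
  all (fun v => all (fun c => 0 <=? zval c v)%ZZ cs) V -> incone B V x ->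
  exists2 w, w \in subsums V & forall c, c \in cs ->
    [/\ (form c x == 0) = (zval c w == 0%ZZ), 0 <= form c x & (0 <=? zval c w)%ZZ].
Proof.
move=> cs20 Bc; elim: V x => [|v V IH] x /=.
  move=> _ xB; exists [::]; rewrite ?inE // => c cc.
  rewrite (@span_form B c) // ?(allP cs20) //.
    by rewrite eqxx /zval !nth_nil.
  by apply/allP => b bB; apply: (allP (allP Bc _ bB)).
case/andP=> v0 V0 [l l0 /(IH _ V0)[w wV wc]].
have [l00|lpos] := eqVneq l 0.
  by exists w; rewrite ?mem_cat ?wV //; rewrite l00 scale0r subr0 in wc.
exists (zlc 1%ZZ v 1%ZZ w); first by rewrite mem_cat map_f ?orbT.
move=> c cc; have c20 := allP cs20 _ cc; have [e f0 w0] := wc _ cc.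
have v0' := allP v0 _ cc; rewrite formB formZ form_vec // in e f0.
have lp : 0 < l by rewrite lt_neqAle eq_sym lpos.
have -> : form c x = l * zr (zval c v) + (form c x - l * zr (zval c v)).
  by rewrite addrCA subrr addr0.
have lv0 : 0 <= l * zr (zval c v) by rewrite mulr_ge0 // zr_ge0.
split; [|exact: addr_ge0|by rewrite zval_zlcD leZ0D].
by rewrite paddr_eq0 // e mulf_eq0 (negPf lpos) /= zr_eq0 zval_zlcD eqZ0D.
Qed.

End Cones.

(** * Cells of the Dressian and lifting strategies *)

Definition term_sign (sg : seq int) (p : pair_idx) : int :=
  nth 0 sg p.1 * nth 0 sg p.2.

Definition orient (sg : seq int) (r : three_term) : three_term :=
  let a := term_sign sg r.1.1 in
  let b := - term_sign sg r.1.2 in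
  let c := term_sign sg r.2 in
  if b == c then r
  else if a == c then (r.1.2, r.1.1, r.2)
  else (r.2, r.1.1, r.1.2).

Definition conds (rs : seq three_term) : seq cond :=
  flatten [seq [:: cond_u r; cond_v r] | r <- rs].

Definition zstate (cs : seq cond) (w : zvec) : bitseq :=
  [seq (zval c w =? 0)%ZZ | c <- cs].

Fixpoint eqbits (s t : bitseq) : bool :=
  match s, t with
  | [::], [::] => true
  | a :: s', b :: t' => if eqb a b then eqbits s' t' else false
  | _, _ => false
  end.

Fixpoint dedup (s : seq bitseq) : seq bitseq :=
  if s is x :: s' then
    let t := dedup s' in if hasf (eqbits x) t then t else x :: t
  else [::].

Definition cells (cs : seq cond) (cv : seq gencone) : seq bitseq :=
  dedup [seq zstate cs w | w <- flatten [seq subsums c.2 | c <- cv]].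

Definition solutions (cs : seq cond) : seq zvec :=
  foldl (fun B c => if pivot c B is Some (_, B') then B' else B) zfull.1 cs.

Definition cell_dim (cs : seq cond) (s : bitseq) : nat :=
  size (solutions (mask s cs)).

(** Fewer ties mean a larger cell: [sub_state s' s] encodes the inclusion of the cell of [s] in that
    of [s'], see [zcell_sub]. *)
Fixpoint sub_state (s t : bitseq) : bool :=
  match s, t with
  | a :: s', b :: t' => if (if a then b else true) then sub_state s' t' else false
  | _, _ => true
  end.

(** The two conditions of a relation are adjacent in [conds], and one of them must be tied because
    the minimum is attained. *)
Fixpoint pairs_ok (s : bitseq) : bool :=
  if s is a :: b :: s' then (a || b) && pairs_ok s' else true.

(* [(d, i, j, k, m)]: the coordinate [i] is obtained from [q_i q_j = q_k + q_m]
   if [d = false], and from [q_i q_j = q_k - q_m] if [d = true]. *)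
Definition lift_step := (bool * nat * nat * pair_idx * pair_idx)%type.

(** In absolute values an oriented relation is [q_t q_t' = q_u q_u' + q_v q_v']. Solving for a
    factor of the [t] term adds positive numbers and is always safe. Solving for a factor of the [u]
    term subtracts the [v] term, which is negligible when [u] ties with [t] and [v] does not;
    likewise with [u] and [v] exchanged. *)
Definition rel_steps (r : three_term) (a b : bool) : seq lift_step :=
  let: (t, u, v) := r in
  [:: (false, t.1, t.2, u, v); (false, t.2, t.1, u, v)]
  ++ (if a && ~~ b then
        [:: (true, u.1, u.2, t, v); (true, u.2, u.1, t, v)] else [::])
  ++ (if b && ~~ a then
        [:: (true, v.1, v.2, t, u); (true, v.2, v.1, t, u)] else [::]).

Fixpoint lift_steps (k : nat) (rs : seq three_term) (s : bitseq) :
    seq (lift_step * nat) :=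
  match rs, s with
  | r :: rs', a :: b :: s' =>
    [seq (st, k) | st <- rel_steps r a b] ++ lift_steps k.+1 rs' s'
  | _, _ => [::]
  end.

Definition step_valid (known : bitseq) (st : lift_step) : bool :=
  let: (_, i, j, k, m) := st in
  if nth false known i then false
  else allf (nth false known) [:: j; k.1; k.2; m.1; m.2].

Fixpoint derive (fuel : nat) (steps : seq (lift_step * nat))
    (known used : bitseq) : bitseq * bitseq :=
  if fuel is n.+1 then
    let i := find (fun st => step_valid known st.1) steps in
    if (i < size steps)%N then
      let: (st, k) := nth (false, 0, 0, (0, 0), (0, 0), 0)%N steps i in
      derive n steps (set_nth false known st.1.1.1.2 true)
             (set_nth false used k true)
    else (known, used)
  else (known, used).

Definition others (k : nat) : seq nat := [seq j <- iota 0 6 | j != k].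

(* The relations [R_(s,j)] with [s] fixed, resp. [j] fixed, are the five 4 x 4
   Pfaffians of a skew-symmetric 5 x 5 matrix. *)
Definition row_group (s : nat) : seq (nat * nat) := [seq (s, e) | e <- others s].
Definition col_group (j : nat) : seq (nat * nat) := [seq (e, j) | e <- others j].
Definition pf_groups : seq (seq nat) := Eval vm_compute in
  [seq [seq index k relkeys | k <- g]
  | g <- [seq row_group s | s <- iota 0 6] ++ [seq col_group s | s <- iota 0 6]].

(** Three vanishing Pfaffians of a group force the other two to vanish, by [pfaffians_eq0]. *)
Definition close_once (used : bitseq) : bitseq :=
  foldl (fun us g => if (2 < count (nth false us) g)%N then
     foldl (fun us k => set_nth false us k true) us g else us) used pf_groups.

(** The fuel 10 is the number of coordinates missing from a base, each step supplying one. Six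
    rounds of closure suffice for the data below; surplus rounds do no harm. *)
Definition liftable (rs : seq three_term) (s : bitseq) (base : seq nat) : bool :=
  let: (known, used) := derive 10 (lift_steps 0 rs s)
     [seq k \in base | k <- iota 0 20] [::] in
  if allf (nth false known) (iota 0 20) then
    allf (nth false (iter 6 close_once used)) (iota 0 30)
  else false.

(** The test on the cones of [cv] is the converse of the covering property. Requiring every cell to
    lie in a liftable cell of dimension 10 yields both purity and the lifting. The dimensions 7 to
    10 are 1 to 4 plus the dimension 6 of the lineality space. *)
Definition check_cells (rs : seq three_term) (bases : seq (seq nat))
    (f : seq nat) : bool :=
  let cs := conds rs in
  let cv := cover rs in
  let cl := cells cs cv in
  let ds := [seq (s, cell_dim cs s) | s <- cl] in
  let top := [seq p.1 | p <- ds & if (p.2 == 10)%N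
                                  then hasf (liftable rs p.1) bases else false] in
  [&& all rel_lt20 rs,
      all (fun c => all (fun b => all (fun c => zval c b =? 0)%ZZ cs) c.1
        && all (fun v => all (fun c => 0 <=? zval c v)%ZZ cs) c.2) cv,
      all pairs_ok cl,
      all (fun s => hasf (fun s' => sub_state s' s) top) cl &
      [seq count (fun p => p.2 == d) ds | d <- [:: 7; 8; 9; 10]%N] == f].

(** * Kernels of integer forms and their dimensions *)

Section CellDimension.
Variable R : realType.
Notation E := 'rV[R]_(plN 3 6).
Notation vec := (@vec R).
Implicit Types (x : E) (c : cond) (B : seq zvec).

Lemma pivot_span c B b B' : cond_lt20 c -> pivot c B = Some (b, B') ->
  [/\ size B = (size B').+1, vec b \in <<map vec B>>%VS &
      forall x, x \in <<map vec B'>>%VS <->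
        x \in <<map vec B>>%VS /\ form c x = 0].
Proof.
move=> c20 pB; have [b0 _] := @pivot_Some R _ _ _ _ c20 pB.
have bB : vec b \in <<map vec B>>%VS.
  move: pB; rewrite /pivot; case: ifP => // iB [<- _].
  set d := nth _ _ _; have dB : vec d \in <<map vec B>>%VS.
    by apply: memv_span; apply: map_f; apply: mem_nth.
  by case: ifP => // _; rewrite vec_zlc zr0 scale0r addr0 memvZ.
have sB : size B = (size B').+1.
  move: pB; rewrite /pivot; case: ifP => // iB [_ <-].
  rewrite size_map size_cat size_take size_drop iB; lia.
split=> // x; split=> [xB'|[xB cx]].
  have : (<<map vec B'>> <= <<map vec B>>)%VS /\
      all (fun b => zval c b == 0%ZZ) B'.
    move: pB; rewrite /pivot; case: ifP => // iB [eb <-]; rewrite eb.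
    split.
      apply/span_subvP => _ /mapP[_ /mapP[v vB ->] ->].
      rewrite vec_proj // /projR memvB ?memvZ //; apply: memv_span.
      apply: map_f; move: vB; rewrite mem_cat => /orP[/mem_take //|/mem_drop //].
    rewrite all_map; apply/allP => v _ /=; rewrite -(zr_eq0 R) -form_vec //.
    by rewrite vec_proj // /projR formB !formZ !form_vec // mulrC subrr.
  case=> /subvP sB' B'0; split; first exact: sB'.
  exact: span_form B'0 xB'.
have [|y yB' [l [_ l0] ->]] := @pivot_incone R c B [::] b B' x c20 pB _ xB.
  by rewrite cx.
by rewrite l0 // scale0r addr0.
Qed.

Definition form_kernel (cs : seq cond) : set E :=
  [set x | forall c, c \in cs -> form c x = 0].

Lemma solutions_sound (cs : seq cond) : all cond_lt20 cs ->
  (forall x, x \in <<map vec (solutions cs)>>%VS <-> form_kernel cs x) /\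
  \dim <<map vec (solutions cs)>> = size (solutions cs).
Proof.
suff H B : \dim <<map vec B>> = size B -> all cond_lt20 cs ->
    let B' := foldl (fun B c => if pivot c B is Some (_, B') then B' else B) B cs in
    (forall x, x \in <<map vec B'>>%VS <->
       x \in <<map vec B>>%VS /\ form_kernel cs x) /\
    \dim <<map vec B'>> = size B'.
  move=> cs20; have [] := H zfull.1 _ cs20.
    have -> : <<map vec zfull.1>>%VS = fullv.
      by apply/vspaceP => x; rewrite zfull_span memvf.
    by rewrite dimvf /dim /= mul1n plN36.
  move=> h1 h2; split=> // x; rewrite h1; split=> [[]//|h]; split=> //.
  exact: zfull_span.
elim: cs B => [|c cs IH] B dB /=; first by split=> // x; split=> [|[]//]; split.
case/andP=> c20 cs20; case pB: (pivot c B) => [[b B']|]; last first.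
  have [h1 h2] := IH _ dB cs20; split=> // x; rewrite h1; split=> -[xB h].
    split=> // d; rewrite inE => /orP[/eqP->|/h//].
    exact: (@span_form _ B c x c20 (pivot_None pB) xB).
  by split=> // d dcs; apply: h; rewrite inE dcs orbT.
have [sB bB eB] := pivot_span c20 pB.
have dB' : \dim <<map vec B'>> = size B'.
  (* The number of vectors bounds the dimension above. Below, adding the line of [b] recovers the
     span of [B], so at most one dimension is lost. *)
  apply/eqP; rewrite eqn_leq -{1}(size_map vec) dim_span /= -ltnS -sB -dB.
  have [b0 _] := @pivot_Some R _ _ _ _ c20 pB.
  have : (<<map vec B>> <= <<map vec B'>> + <[vec b]>)%VS.
    apply/subvP => x xB; apply/memv_addP.
    exists (x - (form c x / zr R (zval c b)) *: vec b).
      apply/eB; split; first by rewrite memvB ?memvZ.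
      by rewrite formB formZ form_vec // divfK ?gt_eqF // subrr.
    exists ((form c x / zr R (zval c b)) *: vec b); last by rewrite subrK.
    by rewrite memvZ ?memv_line.
  move/dimvS/leq_trans; apply; apply: leq_trans (dimv_add_leqif _ _) _.
  by rewrite dim_vline -[X in (_ <= X)%N]addn1 leq_add2l leq_b1.
have [h1 h2] := IH _ dB' cs20; split=> // x; rewrite h1 eB; split.
  move=> [[xB cx] h]; split=> // d; rewrite inE => /orP[/eqP->//|]; exact: h.
move=> [xB h]; split; last by move=> d dcs; apply: h; rewrite inE dcs orbT.
by split=> //; apply: h; rewrite inE eqxx.
Qed.

End CellDimension.

(** * Lifting tropical points to real points *)

Section Pfaffians.
Variables (F : fieldType) (m : nat -> nat -> F).

Definition pf (a b c d : nat) : F :=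
  m a b * m c d - m a c * m b d + m a d * m b c.

(** The skew-symmetric matrix kills the vector of its signed 4 x 4 Pfaffians; its rows are [S0] to
    [S4]. Row [i] omits the Pfaffian [r_i], so if only [r_i] and [r_j] might be nonzero, it reads
    [m_ij r_j = 0] up to sign. *)
Lemma pfaffians_eq0 :
  (forall a b, (a < b < 5)%N -> m a b != 0) ->
  (2 < count (eq_op^~ 0%R)
     [:: pf 1 2 3 4; pf 0 2 3 4; pf 0 1 3 4; pf 0 1 2 4; pf 0 1 2 3])%N ->
  all (eq_op^~ 0%R)
     [:: pf 1 2 3 4; pf 0 2 3 4; pf 0 1 3 4; pf 0 1 2 4; pf 0 1 2 3].
Proof.
move=> m0; have m01 := m0 0%N 1%N isT; have m02 := m0 0%N 2%N isT.
have m03 := m0 0%N 3%N isT; have m04 := m0 0%N 4%N isT; have m12 := m0 1%N 2%N isT.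
have m13 := m0 1%N 3%N isT; have m14 := m0 1%N 4%N isT; have m23 := m0 2%N 3%N isT.
have m24 := m0 2%N 4%N isT; have m34 := m0 3%N 4%N isT.
have S0 : m 0%N 1%N * pf 0 2 3 4 - m 0%N 2%N * pf 0 1 3 4 + m 0%N 3%N * pf 0 1 2 4
   - m 0%N 4%N * pf 0 1 2 3 = 0 by rewrite /pf; ring.
have S1 : m 0%N 1%N * pf 1 2 3 4 - m 1%N 2%N * pf 0 1 3 4 + m 1%N 3%N * pf 0 1 2 4
   - m 1%N 4%N * pf 0 1 2 3 = 0 by rewrite /pf; ring.
have S2 : m 0%N 2%N * pf 1 2 3 4 - m 1%N 2%N * pf 0 2 3 4 + m 2%N 3%N * pf 0 1 2 4
   - m 2%N 4%N * pf 0 1 2 3 = 0 by rewrite /pf; ring.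
have S3 : m 0%N 3%N * pf 1 2 3 4 - m 1%N 3%N * pf 0 2 3 4 + m 2%N 3%N * pf 0 1 3 4
   - m 3%N 4%N * pf 0 1 2 3 = 0 by rewrite /pf; ring.
have S4 : m 0%N 4%N * pf 1 2 3 4 - m 1%N 4%N * pf 0 2 3 4 + m 2%N 4%N * pf 0 1 3 4
   - m 3%N 4%N * pf 0 1 2 4 = 0 by rewrite /pf; ring.
move: S0 S1 S2 S3 S4.
move: (pf 1 2 3 4) (pf 0 2 3 4) (pf 0 1 3 4) (pf 0 1 2 4) (pf 0 1 2 3).
move=> r0 r1 r2 r3 r4 /=.
have mE (a b : F) : a != 0 -> (a * b == 0) = (b == 0).
  by move=> a0; rewrite mulf_eq0 (negPf a0).
case: (eqVneq r0 0) => [->|n0]; case: (eqVneq r1 0) => [->|n1];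
case: (eqVneq r2 0) => [->|n2]; case: (eqVneq r3 0) => [->|n3];
case: (eqVneq r4 0) => [->|n4] //=;
rewrite !(mulr0, subr0, sub0r, add0r, addr0, oppr0);
move=> /eqP S0 /eqP S1 /eqP S2 /eqP S3 /eqP S4; move: S0 S1 S2 S3 S4;
by rewrite ?oppr_eq0 !mE // ?(negPf n0) ?(negPf n1) ?(negPf n2) ?(negPf n3)
  ?(negPf n4).
Qed.

End Pfaffians.

(* The entry [(a, b)] of the skew-symmetric matrix of a group of relations. *)
Definition group_entry (g : nat) (a b : nat) : nat :=
  if (g < 6)%N then tpos g (nth 0 (others g) a)%N (nth 0 (others g) b)%N
  else let e := others (g - 6) in
       let q := quad_without [:: g - 6; nth 0 e a; nth 0 e b]%N in
       tpos (nth 0 q 0)%N (nth 0 q 1)%N (nth 0 q 2)%N.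

Definition group_rel (g : nat) (a b c d : nat) : three_term :=
  let e := group_entry g in ((e a b, e c d), (e a c, e b d), (e a d, e b c)).

Definition group_rels (g : nat) : seq three_term :=
  [:: group_rel g 1 2 3 4; group_rel g 0 2 3 4; group_rel g 0 1 3 4;
      group_rel g 0 1 2 4; group_rel g 0 1 2 3].

(** In a group with the omitted element fixed, matrix entries are indexed by complements, which
    exchanges the two factors of every product. *)
Definition swap_pairs (r : three_term) : three_term :=
  ((r.1.1.2, r.1.1.1), (r.1.2.2, r.1.2.1), (r.2.2, r.2.1)).

Definition rel0 : three_term := ((0, 0), (0, 0), (0, 0))%N.

Lemma pf_groups_rels : all (fun g =>
    (([seq nth rel0 rels k | k <- nth [::] pf_groups g] == group_rels g)
     || ([seq nth rel0 rels k | k <- nth [::] pf_groups g]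
          == map swap_pairs (group_rels g)))
    && all (fun a => all (fun b => (a < b < 5) ==> (group_entry g a b < 20))%N
              (iota 0 5)) (iota 0 5))
  (iota 0 12).
Proof. by vm_compute. Qed.

Section Closure.
Variables (F : fieldType) (p : nat -> F).
Hypothesis p0 : forall k, (k < 20)%N -> p k != 0.

Lemma rel_eval_swap r : rel_eval p (swap_pairs r) = rel_eval p r.
Proof.
case: r => [[[a a'] [b b']] [c c']]; rewrite /rel_eval /=.
by rewrite [p a' * _]mulrC [p b' * _]mulrC [p c' * _]mulrC.
Qed.

Lemma pf_group_closed g : g \in pf_groups ->
  (2 < count (fun k => rel_eval p (nth rel0 rels k) == 0%R) g)%N ->
  {in g, forall k, rel_eval p (nth rel0 rels k) = 0}.
Proof.
move=> gg; set i := index g pf_groups.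
have i12 : (i < 12)%N by rewrite -[12%N]/(size pf_groups) index_mem.
have eg : nth [::] pf_groups i = g by rewrite nth_index.
have := allP pf_groups_rels i; rewrite mem_iota add0n => /(_ i12).
rewrite eg => /andP[hg /allP h20].
have m0 a b : (a < b < 5)%N -> p (group_entry i a b) != 0.
  move=> /andP[ab b5]; apply: p0.
  have := h20 a; rewrite mem_iota add0n => /(_ (ltn_trans ab b5))/allP/(_ b).
  by rewrite mem_iota add0n => /(_ b5); rewrite ab b5.
have H := @pfaffians_eq0 F (fun a b => p (group_entry i a b)) m0.
have E : [seq rel_eval p (nth rel0 rels k) | k <- g] =
    map (rel_eval p) (group_rels i).
  rewrite (map_comp (rel_eval p) (nth rel0 rels)).
  case/orP: hg => /eqP->; first by [].
  move: (group_rels i) => l.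
  by rewrite -map_comp; apply: eq_map => r; exact: rel_eval_swap.
have -> : count (fun k => rel_eval p (nth rel0 rels k) == 0) g =
   count (eq_op^~ 0%R) [seq rel_eval p (nth rel0 rels k) | k <- g].
  by rewrite count_map.
rewrite E => /H h k kg; apply/eqP.
have : all (eq_op^~ 0%R) [seq rel_eval p (nth rel0 rels k) | k <- g].
  by rewrite E.
by rewrite all_map => /allP/(_ _ kg).
Qed.

Definition rels_hold (used : bitseq) : Prop :=
  forall k, nth false used k -> rel_eval p (nth rel0 rels k) = 0.

Lemma close_once_sound used : rels_hold used -> rels_hold (close_once used).
Proof.
rewrite /close_once; have : {subset pf_groups <= pf_groups} by [].
elim: {1 3}pf_groups used => [|g gs IH] used sg hu //=.
apply: IH; first by move=> h hgs; apply: sg; rewrite inE hgs orbT.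
case: ifP => // cg; have {}cg :
    (2 < count (fun k => rel_eval p (nth rel0 rels k) == 0%R) g)%N.
  by apply: leq_trans cg _; apply: sub_count => k /hu ->; rewrite eqxx.
have := pf_group_closed (sg _ (mem_head _ _)) cg.
elim: g used hu {cg sg} => [|k g IHg] used hu hg //=.
apply: IHg => [l|l lg]; last by apply: hg; rewrite inE lg orbT.
rewrite nth_set_nth /=; case: eqP => [-> _|_]; last exact: hu.
by apply: hg; rewrite inE eqxx.
Qed.

Lemma iter_close_sound n used :
  rels_hold used -> rels_hold (iter n close_once used).
Proof. by move=> h; elim: n => //= n; apply: close_once_sound. Qed.

End Closure.

(** * Arithmetic of positive reals with valuations known up to a bounded error *)

Section Near.
Variable R : realType.
Implicit Types (C q z : R).

(* [q] has "valuation" [z] up to the bounded error [C]. *)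
Definition near C q z : Prop := expR (- C - z) <= q <= expR (C - z).

Lemma near_gt0 C q z : near C q z -> 0 < q.
Proof. by case/andP=> h _; apply: lt_le_trans h; exact: expR_gt0. Qed.

Lemma near_weaken C D q z : C <= D -> near C q z -> near D q z.
Proof.
move=> CD /andP[h1 h2]; apply/andP; split.
  by apply: le_trans h1; rewrite ler_expR; lra.
by apply: le_trans h2 _; rewrite ler_expR; lra.
Qed.

Lemma near_expR z : near 0 (expR (- z)) z.
Proof. by rewrite /near oppr0 sub0r lexx. Qed.

Lemma nearM C D q q' z z' :
  near C q z -> near D q' z' -> near (C + D) (q * q') (z + z').
Proof.
move=> nq nq'; have q0 := ltW (near_gt0 nq); have q'0 := ltW (near_gt0 nq').
case/andP: nq => h1 h2; case/andP: nq' => h3 h4; rewrite /near.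
have -> : - (C + D) - (z + z') = (- C - z) + (- D - z') by ring.
have -> : C + D - (z + z') = (C - z) + (D - z') by ring.
by rewrite (expRD (- C - z)) (expRD (C - z)) !ler_pM ?expR_ge0.
Qed.

Lemma nearV C q z : near C q z -> near C q^-1 (- z).
Proof.
move=> nq; have q0 := near_gt0 nq; case/andP: nq => h1 h2; apply/andP; split.
  have -> : - C - - z = - (C - z) by ring.
  by rewrite expRN lef_pV2 // posrE ?expR_gt0.
have -> : C - - z = - (- C - z) by ring.
by rewrite expRN lef_pV2 // posrE ?expR_gt0.
Qed.

Lemma expR1_ge2 : 2 <= expR 1 :> R.
Proof. by have := expR_ge1Dx (1 : R). Qed.

(** Positive terms cannot cancel, so the sum is at least the dominant term and at most twice the
    common upper bound; the factor 2 is absorbed by [expR 1], whence the extra 1. *)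
Lemma near_add C a b x y z : 0 <= C -> near C a x -> near C b y ->
  z <= x -> z <= y -> z = x \/ z = y -> near (C + 1) (a + b) z.
Proof.
move=> C0 na nb zx zy xy; have a0 := near_gt0 na; have b0 := near_gt0 nb.
case/andP: na => h1 h2; case/andP: nb => h3 h4; apply/andP; split.
  have le1 : expR (- (C + 1) - z) <= expR (- C - z) by rewrite ler_expR; lra.
  apply: le_trans le1 _; case: xy => ->.
    by apply: le_trans h1 _; lra.
  by apply: le_trans h3 _; lra.
have ax : a <= expR (C - z) by apply: le_trans h2 _; rewrite ler_expR; lra.
have bx : b <= expR (C - z) by apply: le_trans h4 _; rewrite ler_expR; lra.
have -> : C + 1 - z = 1 + (C - z) by ring.
rewrite (expRD 1); apply: le_trans (lerD ax bx) _.
by rewrite -mulr2n -mulr_natl ler_wpM2r ?expR_ge0 ?expR1_ge2.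
Qed.

(** The gap [2 * C + 1] makes [b] at most half of the lower bound for [a], since
    [expR (- 1) <= 1 / 2]. *)
Lemma near_sub C a b x y : 0 <= C -> near C a x -> near C b y ->
  x + (2 * C + 1) <= y -> near (C + 1) (a - b) x.
Proof.
move=> C0 na nb xy; have a0 := near_gt0 na; have b0 := near_gt0 nb.
case/andP: na => h1 h2; case/andP: nb => h3 h4.
have e0 := expR_gt0 (- C - x).
have hb : b * 2 <= expR (- C - x).
  have : b <= expR (- 1 + (- C - x)) by apply: le_trans h4 _; rewrite ler_expR; lra.
  rewrite (expRD (- 1)) expRN mulrC ler_pdivlMr ?expR_gt0 //.
  by apply: le_trans; rewrite ler_wpM2l ?expR1_ge2 // ltW.
apply/andP; split; last first.
  apply: (@le_trans _ _ a); first lra.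
  by apply: le_trans h2 _; rewrite ler_expR; lra.
have -> : - (C + 1) - x = - 1 + (- C - x) by ring.
rewrite (expRD (- 1)) expRN; apply: (@le_trans _ _ (2^-1 * expR (- C - x))).
  rewrite ler_wpM2r ?expR_ge0 // lef_pV2 ?posrE ?expR_gt0 ?expR1_ge2 //.
lra.
Qed.

End Near.

(** * Deriving all coordinates from a base, uniformly deep inside a cell *)

Section Lift.
Variables (R : realType) (rs : seq three_term) (w : zvec).
Notation E := 'rV[R]_(plN 3 6).
Notation cs := (conds rs).

(* [z] lies in the cell of [w], at distance at least [M] from its walls. *)
Definition deep (M : R) (z : E) : Prop := forall c, c \in cs ->
  (zval c w = 0%ZZ -> form c z = 0) /\ (zval c w <> 0%ZZ -> M <= form c z).

Definition pos_rel (r : three_term) (q : nat -> R) : Prop :=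
  q r.1.1.1 * q r.1.1.2 = q r.1.2.1 * q r.1.2.2 + q r.2.1 * q r.2.2.

Definition step_eq (st : lift_step) (q : nat -> R) : Prop :=
  let: (d, i, j, k, m) := st in
  q i * q j = if d then q k.1 * q k.2 - q m.1 * q m.2
              else q k.1 * q k.2 + q m.1 * q m.2.

Definition pair_val (z : E) (k : pair_idx) : R := z 0 (ix k.1) + z 0 (ix k.2).

Definition step_trop (M : R) (st : lift_step) (z : E) : Prop :=
  let: (d, i, j, k, m) := st in
  let t := z 0 (ix i) + z 0 (ix j) in
  if d then t = pair_val z k /\ pair_val z k + M <= pair_val z m
  else [/\ t <= pair_val z k, t <= pair_val z m &
           t = pair_val z k \/ t = pair_val z m].

Definition step_indices (st : lift_step) : seq nat :=
  let: (_, i, j, k, m) := st in [:: i; j; k.1; k.2; m.1; m.2].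

Definition rel_indices (r : three_term) : seq nat :=
  [:: r.1.1.1; r.1.1.2; r.1.2.1; r.1.2.2; r.2.1; r.2.2].

Lemma conds_mem r : r \in rs -> cond_u r \in cs /\ cond_v r \in cs.
Proof.
move=> rr; split; apply/flattenP; exists [:: cond_u r; cond_v r];
  by rewrite ?inE ?eqxx ?orbT //; apply: map_f.
Qed.

Definition zero_at c := (zval c w =? 0)%ZZ.

Lemma rel_steps_sound (r : three_term) st : r \in rs ->
  st \in rel_steps r (zero_at (cond_u r)) (zero_at (cond_v r)) ->
  zero_at (cond_u r) || zero_at (cond_v r) ->
  [/\ forall q, step_eq st q -> pos_rel r q,
      {subset rel_indices r <= step_indices st} &
      forall M z, 0 <= M -> deep M z -> step_trop M st z].
Proof.
move=> rr; have [uc vc] := conds_mem rr.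
have D M z : 0 <= M -> deep M z ->
   [/\ 0 <= form (cond_u r) z, 0 <= form (cond_v r) z,
      zero_at (cond_u r) -> form (cond_u r) z = 0,
      zero_at (cond_v r) -> form (cond_v r) z = 0 &
      (~~ zero_at (cond_u r) -> M <= form (cond_u r) z) /\
      (~~ zero_at (cond_v r) -> M <= form (cond_v r) z)].
  move=> M0 dz; have [du du'] := dz _ uc; have [dv dv'] := dz _ vc.
  rewrite /zero_at; case: Z.eqb_spec => [/du ->|/du' hu];
    case: Z.eqb_spec => [/dv ->|/dv' hv];
    by split=> //; apply: le_trans M0 _.
move: (zero_at (cond_u r)) (zero_at (cond_v r)) D => a b.
case: r rr uc vc => [[t u] v] /= rr uc vc.
rewrite /form /= => D st_in ab.
have {}st_in : [\/ st = (false, t.1, t.2, u, v) \/ st = (false, t.2, t.1, u, v),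
   [/\ a, ~~ b & st = (true, u.1, u.2, t, v) \/ st = (true, u.2, u.1, t, v)] |
   [/\ b, ~~ a & st = (true, v.1, v.2, t, u) \/ st = (true, v.2, v.1, t, u)]].
  move: st_in; rewrite !inE => /or3P[/eqP h|/eqP h|].
  - by constructor 1; left.
  - by constructor 1; right.
  rewrite mem_cat => /orP[]; case: ifP => // /andP[-> ->].
    by rewrite !inE => /orP[]/eqP h; constructor 2; split=> //; auto.
  by rewrite !inE => /orP[]/eqP h; constructor 3; split=> //; auto.
case: st_in => [[]->|[ha hb []->]|[hb ha []->]]; split.
all: try by move=> q /=; rewrite /pos_rel /=; lra.
all: try by move=> k; rewrite /rel_indices /step_indices /= !inE =>
  /or4P[|||/or3P[]] /eqP->; rewrite eqxx ?orbT.
all: move=> M z M0 /(D _ _ M0) [u0 v0 h1 h2 [h3 h4]].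
all: rewrite /step_trop /pair_val /=.
1,2: have {ab} [/h1 e|/h2 e] : a \/ b by apply/orP.
1-4: split; [lra|lra|].
1,3: by left; lra.
1,2: by right; lra.
1,2: by have := h1 ha; have := h4 hb; split; lra.
all: by have := h2 hb; have := h3 ha; split; lra.
Qed.

Lemma lift_stepsP k0 (rs' : seq three_term) st k :
  (st, k) \in lift_steps k0 rs' (zstate (conds rs') w) ->
  exists2 j, (k = k0 + j)%N /\ (j < size rs')%N &
    let r := nth rel0 rs' j in
    st \in rel_steps r (zero_at (cond_u r)) (zero_at (cond_v r)).
Proof.
elim: rs' k0 => [|r rs' IH] k0 //=; rewrite mem_cat => /orP[].
  case/mapP=> st' hst [-> ->]; exists 0%N; first by rewrite addn0.
  exact: hst.
by case/IH=> j [-> js] hst; exists j.+1; rewrite ?addnS.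
Qed.

(** [C] and [M] are chosen before [z], so the error stays bounded while [z] goes to infinity. That a
    used relation involves known coordinates only keeps it true when a later step redefines an
    unknown one. *)
Definition lifted (known used : bitseq) : Prop :=
  exists2 C : R, 0 <= C & exists2 M : R, 0 <= M & forall z, deep M z ->
    exists2 q : nat -> R, (forall i, nth false known i -> near C (q i) (z 0 (ix i)))
    & forall k, nth false used k -> [/\ (k < size rs)%N,
        pos_rel (nth rel0 rs k) q &
        all (nth false known) (rel_indices (nth rel0 rs k))].

Hypothesis rs_ok : {in rs, forall r, zero_at (cond_u r) || zero_at (cond_v r)}.

Lemma lifted_step known used st k :
  (st, k) \in lift_steps 0 rs (zstate cs w) -> step_valid known st ->
  lifted known used ->
  lifted (set_nth false known st.1.1.1.2 true) (set_nth false used k true).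
Proof.
case/lift_stepsP=> j0 [-> js]; rewrite add0n /=; set r := nth _ _ _ => hst sv.
have rr : r \in rs by apply: mem_nth.
have [heq hidx htrop] := rel_steps_sound rr hst (rs_ok rr).
(* A product of two coordinates has error [2 * C], the sum or difference adds 1, and the division by
   [q j] adds [C]. *)
case=> C C0 [M M0 H]; exists (3 * C + 1); first lra.
(* [4 * C + 1] is the gap that [near_sub] demands of products with error [2 * C]. *)
exists (Num.max M (4 * C + 1)); first by rewrite le_max M0.
move=> z dz; have dzM : deep M z.
  move=> c cc; have [h1 h2] := dz c cc; split=> // h; apply: le_trans (h2 h).
  by rewrite le_max lexx.
have {H dzM} [q qn qu] := H z dzM.
have {htrop dz}  := htrop _ z _ dz; rewrite le_max M0 => /(_ isT).
case: st sv hst heq hidx => [[[[d i] j] k'] m] sv hst heq hidx htr.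
have {sv} [ik /allP jk] : ~~ nth false known i /\
    all (nth false known) [:: j; k'.1; k'.2; m.1; m.2].
  by move: sv => /=; do 6!case: (nth false known _).
have nk e : e \in [:: j; k'.1; k'.2; m.1; m.2] -> near C (q e) (z 0 (ix e)).
  by move=> /jk; apply: qn.
have nj := nk j (mem_head _ _).
have nK : near (C + C) (q k'.1 * q k'.2) (pair_val z k').
  by apply: nearM; apply: nk; rewrite !inE eqxx ?orbT.
have nM : near (C + C) (q m.1 * q m.2) (pair_val z m).
  by apply: nearM; apply: nk; rewrite !inE eqxx ?orbT.
pose v := (if d then q k'.1 * q k'.2 - q m.1 * q m.2
           else q k'.1 * q k'.2 + q m.1 * q m.2).
pose q' e := if e == i then v / q j else q e.
have nv : near (C + C + 1) v (z 0 (ix i) + z 0 (ix j)).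
  rewrite /v; case: (d) htr.
    case=> -> le1; apply: near_sub nK nM _; first lra.
    by apply: le_trans le1; rewrite lerD2l le_max; apply/orP; right; lra.
  by case=> ? ? ?; apply: near_add nK nM _ _ _ => //; lra.
have q'E e : nth false known e -> q' e = q e.
  by rewrite /q'; case: eqP => // -> ke; rewrite ke in ik.
exists q' => [e|l]; rewrite nth_set_nth /=.
  rewrite /q'; case: eqP => [-> _|_ ke].
    have -> : z 0 (ix i) = z 0 (ix i) + z 0 (ix j) + - z 0 (ix j) by rewrite addrK.
    have -> : 3 * C + 1 = C + C + 1 + C by ring.
    by apply: nearM nv _; apply: nearV.
  by apply: near_weaken (qn _ ke); lra.
have sub e : nth false known e -> nth false (set_nth false known i true) e.
  by rewrite nth_set_nth /=; case: eqP.
case: eqP => [-> _|_ lu]; last first.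
  have [ls lq la] := qu _ lu; split=> //; last by apply: sub_all la.
  rewrite /pos_rel; case/and5P: la => e1 e2 e3 e4 /and3P[e5 e6 _].
  by rewrite !q'E.
split=> //.
  have q'i : q' i = v / q j by rewrite /q' eqxx.
  have E e : e \in [:: j; k'.1; k'.2; m.1; m.2] -> q' e = q e.
    by move=> /jk; apply: q'E.
  apply: heq; rewrite /= q'i !E ?inE ?eqxx ?orbT // -/v divfK //.
  by rewrite gt_eqF // (near_gt0 nj).
suff h : all (nth false (set_nth false known i true)) (rel_indices r) by exact: h.
apply/allP => e /hidx; rewrite inE => /orP[/eqP->|/jk /sub //].
by rewrite nth_set_nth /= eqxx.
Qed.

Lemma lifted_derive n known used :
  lifted known used ->
  let: (known', used') := derive n (lift_steps 0 rs (zstate cs w)) known used in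
  lifted known' used'.
Proof.
elim: n known used => [|n IH] known used h //=.
set steps := lift_steps _ _ _; case: ifP => // hi.
have := @nth_find _ (false, 0, 0, (0, 0), (0, 0), 0)%N
  (fun st => step_valid known st.1) steps; rewrite has_find hi => /(_ isT).
have := mem_nth (false, 0, 0, (0, 0), (0, 0), 0)%N hi.
case: (nth _ _ _) => st k hin hv; apply: IH.
exact: lifted_step.
Qed.

Lemma lifted_base known : lifted known [::].
Proof.
exists 0 => //; exists 0 => // z _; exists (fun i => expR (- z 0 (ix i))).
  by move=> i _; exact: near_expR.
by move=> k; rewrite nth_nil.
Qed.

Lemma liftableP base : liftable rs (zstate cs w) base ->
  exists2 C : R, 0 <= C & exists2 M : R, 0 <= M & exists2 used : bitseq,
    all (nth false (iter 6 close_once used)) (iota 0 30) &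
    forall z, deep M z -> exists2 q : nat -> R,
      (forall i, (i < 20)%N -> near C (q i) (z 0 (ix i))) &
      (forall k, nth false used k -> (k < size rs)%N /\ pos_rel (nth rel0 rs k) q).
Proof.
rewrite /liftable; have := @lifted_derive 10 _ _
  (lifted_base [seq k \in base | k <- iota 0 20]).
case: (derive _ _ _ _) => known used [C C0 [M M0 H]].
case: ifP => //; rewrite !allfE => /allP hk hu.
exists C => //; exists M => //; exists used => // z /H[q qn qu]; exists q.
  by move=> i i20; apply: qn; apply: hk; rewrite mem_iota.
by move=> k /qu[].
Qed.

End Lift.

(** * Tropical hypersurfaces and refinement fans *)

Section BigMin.
Variables (R : realType) (T : eqType) (F : T -> R).
Notation bmin s := (\big[Order.min/+oo%E]_(m <- s) (F m)%:E).

Lemma bmin_le (s : seq T) m : m \in s -> (bmin s <= (F m)%:E)%E.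
Proof.
elim: s => // n s IH; rewrite inE big_cons ge_min => /orP[/eqP->|/IH->].
  by rewrite lexx.
by rewrite orbT.
Qed.

Lemma le_bmin (s : seq T) a : (forall m, m \in s -> (a <= (F m)%:E)%E) ->
  (a <= bmin s)%E.
Proof.
elim: s => [|n s IH] h; first by rewrite big_nil leey.
rewrite big_cons le_min h ?mem_head //; apply: IH => m ms.
by apply: h; rewrite inE ms orbT.
Qed.

Lemma le_bminP (s t : seq T) :
  (bmin s <= bmin t)%E <-> forall m, m \in t -> exists2 m', m' \in s & F m' <= F m.
Proof.
split=> [h m mt|h].
  have {h} := le_trans h (bmin_le mt); elim: s => [|n s IH].
    by rewrite big_nil leNgt ltry.
  rewrite big_cons ge_min lee_fin => /orP[nm|/IH[m' m's m'm]].
    by exists n; rewrite ?mem_head.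
  by exists m'; rewrite // inE m's orbT.
apply: le_bmin => m /h [m' m's m'm]; apply: le_trans (bmin_le m's) _.
by rewrite lee_fin.
Qed.

End BigMin.

Section Tropical.
Variables (R : realType) (N : nat).
Implicit Types (f : {mpoly R[N]}) (x y w : 'rV[R]_N) (m : 'X_{1..N}).

Lemma min_termsP f x m : min_terms f x m <->
  m \in msupp f /\ forall m', m' \in msupp f -> exp_dot m x <= exp_dot m' x.
Proof.
rewrite /min_terms /Trop /=; split=> -[mf h]; split=> //.
  move=> m' m'f; rewrite -lee_fin h.
  exact: (@bmin_le R _ (fun m => exp_dot m x) _ _ m'f).
apply/eqP; rewrite eq_le (@bmin_le R _ (fun m => exp_dot m x)) // andbT.
by apply: (@le_bmin R _ (fun m => exp_dot m x)) => m' /h; rewrite lee_fin.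
Qed.

Definition term_sgn (chi : 'I_N -> int) f m : R :=
  Num.sg ((f@_m *: 'X_[m]).@[fun i => (chi i)%:~R]).

Lemma msupp_sign_part chi s f m : (m \in msupp (sign_part chi s f)) =
  (m \in msupp f) && (term_sgn chi f m == s).
Proof.
rewrite mcoeff_msupp /sign_part raddf_sum /= big_mkcond /=.
have E m' : (if term_sgn chi f m' == s then (f@_m' *: 'X_[m'])@_m else 0) =
    (if (m' == m) && (term_sgn chi f m == s) then f@_m else 0).
  rewrite mcoeffZ mcoeffX; case: (eqVneq m' m) => [->|] /=; rewrite ?mulr1 //.
  by rewrite mulr0 if_same.
rewrite (eq_bigr (fun m' => if (m' == m) && (term_sgn chi f m == s)
  then f@_m else 0)); last by move=> m' _; exact: E.
case ms: (_ == s); last first.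
  by rewrite big1 ?andbF ?eqxx // => m' _; rewrite andbF.
rewrite andbT -big_mkcond /= (eq_bigl (pred1 m)); last first.
  by move=> m'; rewrite /= andbT.
case mf: (m \in msupp f); last first.
  by rewrite big_seq_cond big1 ?eqxx // => m' /andP[m'f /eqP e]; rewrite e mf in m'f.
rewrite -big_filter filter_pred1_uniq ?msupp_uniq // big_seq1.
by rewrite -mcoeff_msupp mf.
Qed.

Lemma TropVP chi f x : TropV chi f x <-> forall s : R, s \in [:: 1; -1] ->
  forall m, m \in msupp f -> term_sgn chi f m = s ->
  exists2 m', m' \in msupp f /\ term_sgn chi f m' = - s &
    exp_dot m' x <= exp_dot m x.
Proof.
rewrite /TropV /Trop /=.
have E s m : (m \in msupp (sign_part chi s f)) <->
    m \in msupp f /\ term_sgn chi f m = s.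
  by rewrite msupp_sign_part; split=> [/andP[-> /eqP]|[-> /eqP]].
have L s t : (\big[Order.min/+oo%E]_(m <- msupp (sign_part chi s f)) (exp_dot m x)%:E
   <= \big[Order.min/+oo%E]_(m <- msupp (sign_part chi t f)) (exp_dot m x)%:E)%E
   <-> forall m, m \in msupp f -> term_sgn chi f m = t ->
  exists2 m', m' \in msupp f /\ term_sgn chi f m' = s & exp_dot m' x <= exp_dot m x.
  rewrite (@le_bminP R _ (fun m => exp_dot m x)); split=> h m.
    by move=> mf mt; have [|m' /E m's] := h m; [apply/E|exists m'].
  by move=> /E[mf mt]; have [m' m's] := h m mf mt; exists m' => //; apply/E.
split=> [e s|h].
  by rewrite !inE => /orP[]/eqP->; apply/L; rewrite ?opprK e.
apply/eqP; rewrite eq_le; apply/andP; split; apply/L.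
  by rewrite -{2}[1]opprK; apply: h; rewrite !inE eqxx orbT.
by apply: h; rewrite inE eqxx.
Qed.

Definition mrow m : 'rV[R]_N := \row_i (m i)%:R.

Lemma dotp_is_scalar (a : 'rV[R]_N) : scalar (dotp a).
Proof.
move=> k x y; rewrite /dotp mulr_sumr -big_split; apply: eq_bigr => i _.
by rewrite !mxE mulrDr mulrCA.
Qed.

HB.instance Definition _ (a : 'rV[R]_N) :=
  GRing.isLinear.Build R 'rV[R]_N R _ (dotp a) (dotp_is_scalar a).

Lemma dotpC (a x : 'rV[R]_N) : dotp a x = dotp x a.
Proof. by apply: eq_bigr => i _; rewrite mulrC. Qed.

Lemma exp_dotE m x : exp_dot m x = dotp (mrow m) x.
Proof. by apply: eq_bigr => i _; rewrite mxE. Qed.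

Lemma exp_dotD m x y : exp_dot m (x + y) = exp_dot m x + exp_dot m y.
Proof. by rewrite !exp_dotE linearD. Qed.

Lemma exp_dotZ m (k : R) x : exp_dot m (k *: x) = k * exp_dot m x.
Proof. by rewrite !exp_dotE linearZ. Qed.

Lemma exp_dotN m x : exp_dot m (- x) = - exp_dot m x.
Proof. by rewrite !exp_dotE linearN. Qed.

Lemma exp_dot0 m : exp_dot m (0 : 'rV[R]_N) = 0.
Proof. by rewrite exp_dotE linear0. Qed.

Lemma dotp_mrowB m m' x : dotp (mrow m' - mrow m) x = exp_dot m' x - exp_dot m x.
Proof. by rewrite dotpC linearB /= !(dotpC x) -!exp_dotE. Qed.

Lemma min_terms_ex f x m : m \in msupp f -> exists m', min_terms f x m'.
Proof.
move=> mf; suff [m' m'f h] : exists2 m', m' \in msupp f &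
    forall n, n \in msupp f -> exp_dot m' x <= exp_dot n x.
  by exists m'; apply/min_termsP.
elim: (msupp f) m mf => // n [|p s] IH m _.
  by exists n; rewrite ?inE // => k; rewrite inE => /eqP->.
have [q qs hq] := IH p (mem_head _ _).
have [nq|qn] := leP (exp_dot n x) (exp_dot q x).
  exists n; first exact: mem_head.
  by move=> k; rewrite inE => /orP[/eqP->//|/hq]; apply: le_trans.
exists q; first by rewrite inE qs orbT.
by move=> k; rewrite inE => /orP[/eqP->|/hq//]; apply: ltW.
Qed.

End Tropical.

(** * Fans from common refinements of normal fans of Newton polytopes *)

Section RefinementFan.
Variables (R : realType) (N : nat) (P : set {mpoly R[N]}) (Ps : seq {mpoly R[N]}).
Hypothesis PPs : forall f, P f <-> f \in Ps.
Implicit Types (f : {mpoly R[N]}) (x y w : 'rV[R]_N) (m : 'X_{1..N}).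
Notation cone := (refinement_cone P).

Lemma refinement_coneP w x : cone w x <-> forall f m m', f \in Ps ->
  min_terms f w m -> m' \in msupp f -> exp_dot m x <= exp_dot m' x.
Proof.
split=> [h f m m' /PPs Pf mw m'f|h f /PPs Pf m mw].
  by have /min_termsP[_] := h f Pf m mw; apply.
apply/min_termsP; split; first by case/min_termsP: mw.
by move=> m' m'f; apply: h mw m'f.
Qed.

Lemma refinement_cone_refl w : cone w w.
Proof. by move=> f _. Qed.

Lemma refinement_cone_trans w x y : cone w x -> cone x y -> cone w y.
Proof. by move=> h1 h2 f Pf m /(h1 f Pf)/(h2 f Pf). Qed.

Lemma refinement_cone0 w : cone w 0.
Proof. by apply/refinement_coneP => f m m' _ _ _; rewrite !exp_dot0. Qed.

Lemma refinement_coneD w x y : cone w x -> cone w y -> cone w (x + y).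
Proof.
move=> /refinement_coneP hx /refinement_coneP hy; apply/refinement_coneP.
move=> f m m' Pf mw m'f; rewrite !exp_dotD.
by apply: lerD; [apply: hx Pf mw m'f|apply: hy Pf mw m'f].
Qed.

Definition min_list f w : seq 'X_{1..N} := [seq m <- msupp f | `[< min_terms f w m >]].

Lemma mem_min_list f w m : (m \in min_list f w) <-> min_terms f w m.
Proof.
rewrite mem_filter; split=> [/andP[/asboolP]//|h].
by apply/andP; split; [apply/asboolP|case/min_termsP: h].
Qed.

Lemma refinement_cone_polyhedral w : polyhedral_cone (cone w).
Proof.
exists (flatten [seq [seq mrow R q.2 - mrow R q.1 |
  q <- [seq (m, m') | m <- min_list f w, m' <- msupp f]] | f <- Ps]).
apply/seteqP; split=> x /=.
  move=> /refinement_coneP h a /flatten_mapP[f fP /mapP[q]].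
  case/allpairsP=> -[m m'] /= [/mem_min_list mw m'f -> ->] /=.
  by rewrite dotp_mrowB subr_ge0; apply: h fP mw m'f.
move=> h; apply/refinement_coneP => f m m' fP mw m'f.
rewrite -subr_ge0 -dotp_mrowB; apply: h; apply/flatten_mapP; exists f => //.
apply/mapP; exists (m, m') => //; apply/allpairsP; exists (m, m').
by split=> //; apply/mem_min_list.
Qed.

Lemma min_termsD f w x y m : min_terms f w `<=` min_terms f x ->
  min_terms f w `<=` min_terms f y -> min_terms f (x + y) m ->
  min_terms f x m /\ min_terms f y m.
Proof.
move=> wx wy mxy; have [mf hm] := (min_termsP f (x + y) m).1 mxy.
have [m0 m0w] := min_terms_ex w mf.
have [m0f hx] := (min_termsP f x m0).1 (wx _ m0w).
have [_ hy] := (min_termsP f y m0).1 (wy _ m0w).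
have := hm m0 m0f; rewrite !exp_dotD => le0.
have le1 := hx _ mf; have le2 := hy _ mf.
split; apply/min_termsP; split=> // m' m'f.
  by have := hx _ m'f; lra.
by have := hy _ m'f; lra.
Qed.

(** On a face this number is smallest at its relatively interior points, which is how
    [refinement_face] finds such a point. *)
Definition num_min w : nat := (\sum_(f <- Ps) size (min_list f w))%N.

Lemma min_list_sub f x y : (min_terms f x `<=` min_terms f y) ->
  (size (min_list f x) <= size (min_list f y))%N.
Proof.
move=> h; rewrite !size_filter; apply: sub_count => m /asboolP mx.
by apply/asboolP; apply: h.
Qed.

Lemma min_list_eq f x y : (min_terms f x `<=` min_terms f y) ->
  (size (min_list f y) <= size (min_list f x))%N ->
  min_terms f y `<=` min_terms f x.
Proof.
move=> h sz m my; apply/mem_min_list; have u z : uniq (min_list f z).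
  by rewrite filter_uniq ?msupp_uniq.
have [|_ ->] := uniq_min_size (u x) _ sz; last exact/mem_min_list.
by move=> n /mem_min_list/h/mem_min_list.
Qed.

Lemma num_min_eq x y : (forall f, f \in Ps -> min_terms f x `<=` min_terms f y) ->
  (num_min y <= num_min x)%N ->
  forall f, f \in Ps -> min_terms f y `<=` min_terms f x.
Proof.
rewrite /num_min; elim: Ps => [|g gs IH] h //; rewrite !big_cons => le1 f.
have hg := min_list_sub (h _ (mem_head _ _)).
have hgs : (\sum_(f <- gs) size (min_list f x) <=
   \sum_(f <- gs) size (min_list f y))%N.
  rewrite !big_seq; apply: leq_sum => k kgs; apply: min_list_sub.
  by apply: h; rewrite inE kgs orbT.
rewrite inE => /orP[/eqP->|fgs].
  by apply: min_list_eq; [apply: h; rewrite mem_head|lia].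
apply: IH fgs; last lia.
by move=> k kgs; apply: h; rewrite inE kgs orbT.
Qed.

(** A large multiple of a relatively interior vector outweighs any perturbation that respects the
    ties; this makes [K v - x] and [K w + u] stay in the cone below. *)
Lemma dominating_factor (T : eqType) (s : seq T) (g h : T -> R) :
  {in s, forall i, 0 < g i} -> exists2 K : R, 0 <= K & {in s, forall i, h i <= K * g i}.
Proof.
elim: s => [|i s IH] gs; first by exists 0.
have [|K K0 hK] := IH; first by move=> j js; apply: gs; rewrite inE js orbT.
exists (Num.max K (h i / g i)); first by rewrite le_max K0.
have gi : 0 < g i by apply: gs; rewrite mem_head.
move=> j; rewrite inE => /orP[/eqP->|js].
  by rewrite -ler_pdivrMr // le_max lexx orbT.
apply: le_trans (hK _ js) _; rewrite ler_wpM2r ?le_max ?lexx // ltW //.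
by apply: gs; rewrite inE js orbT.
Qed.

(** Choose [v] in [F] with the fewest minimal terms. For [x] in [F], the minimal terms of [v + x]
    are among those of [v], hence equal to them, so they are minimal at [x] too. Conversely, for [x]
    in [cone v] and large [K], the vector [K v - x] lies in [cone w]; as [a] vanishes at [v], it is
    at most 0 at [x]. *)
Lemma refinement_face w F : is_face F (cone w) -> exists2 v, F v & F = cone v.
Proof.
case=> a a0 eF; have F0 : F 0.
  by rewrite eF; split; [exact: refinement_cone0|rewrite /= linear0].
have FC x : F x -> cone w x /\ dotp a x = 0 by rewrite eF => -[].
pose good n := `[< exists2 v, F v & num_min v = n >].
have exg : exists n, good n by exists (num_min 0); apply/asboolP; exists 0.
case: (ex_minnP exg) => n /asboolP[v Fv vn] nmin; exists v => //.
have [wv av] := FC v Fv.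
apply/seteqP; split=> x.
  move=> Fx; have [wx ax] := FC x Fx.
  have Fvx : F (v + x).
    rewrite eF; split; first exact: refinement_coneD.
    by rewrite /= linearD /= av ax addr0.
  move=> f /[dup] Pf /PPs fP m mv.
  have sub g : g \in Ps -> min_terms g (v + x) `<=` min_terms g v.
    by move=> /PPs Pg k /(min_termsD (wv g Pg) (wx g Pg))[].
  have le1 : (num_min v <= num_min (v + x))%N.
    by rewrite vn; apply: nmin; apply/asboolP; exists (v + x).
  have := num_min_eq sub le1 fP mv.
  by case/(min_termsD (wv f Pf) (wx f Pf)).
move=> vx; have wx := refinement_cone_trans wv vx.
rewrite eF; split=> //=; apply/eqP; rewrite eq_le a0 // andbT.
pose T := flatten [seq [seq (m, m') | m <- min_list f w, m' <- msupp f] | f <- Ps].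
pose g (q : 'X_{1..N} * 'X_{1..N}) := exp_dot q.2 v - exp_dot q.1 v.
pose h (q : 'X_{1..N} * 'X_{1..N}) := exp_dot q.2 x - exp_dot q.1 x.
have [|K K0 hK] := @dominating_factor _ [seq q <- T | 0 < g q] g h.
  by move=> q; rewrite mem_filter => /andP[].
have : cone w (K *: v - x).
  apply/refinement_coneP => f m m' fP mw m'f.
  rewrite !exp_dotD !exp_dotN !exp_dotZ.
  have gE : 0 <= g (m, m').
    by move/refinement_coneP: wv => /(_ _ _ _ fP mw m'f); rewrite /g subr_ge0.
  have [g0|g0] := ltP 0 (g (m, m')).
    have /hK : (m, m') \in [seq q <- T | 0 < g q].
      rewrite mem_filter g0; apply/flatten_mapP; exists f => //.
      by apply/allpairsP; exists (m, m'); split=> //; apply/mem_min_list.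
    by rewrite /h /g /=; lra.
  have eqv : exp_dot m' v = exp_dot m v by move: g0 gE; rewrite /g /=; lra.
  have /PPs Pf := fP.
  have /(vx f Pf)/min_termsP[_ h2] : min_terms f v m'.
    apply/min_termsP; split=> // k kf; rewrite eqv.
    by have /min_termsP[_] := wv f Pf m mw; apply.
  have := h2 m; case/min_termsP: mw => mf _ /(_ mf).
  by rewrite eqv; lra.
move/a0; rewrite linearB linearZ /= av; lra.
Qed.

(** The supporting functional adds up the excess of each term minimal at [v] over a fixed term
    [mw f] minimal at [w]. Each excess is nonnegative on [cone w], and all vanish exactly on
    [cone v]. *)
Lemma refinement_inter w v : is_face (cone w `&` cone v) (cone w).
Proof.
pose mw f := head 0%MM (min_list f w).
have mwP f m : m \in msupp f -> min_terms f w (mw f).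
  move=> mf; have [m' /mem_min_list] := min_terms_ex w mf.
  rewrite /mw; case E: (min_list f w) => [|k s] // _ /=.
  by apply/mem_min_list; rewrite E mem_head.
pose a := \sum_(f <- Ps) \sum_(m <- min_list f v) (mrow R m - mrow R (mw f)).
have aE x : dotp a x = \sum_(f <- Ps) \sum_(m <- min_list f v)
    (exp_dot m x - exp_dot (mw f) x).
  rewrite dotpC linear_sum; apply: eq_bigr => f _; rewrite linear_sum.
  by apply: eq_bigr => m _; rewrite /= dotpC dotp_mrowB.
have ge0 x f m : cone w x -> f \in Ps -> m \in min_list f v ->
    0 <= exp_dot m x - exp_dot (mw f) x.
  move=> /refinement_coneP wx fP /mem_min_list/min_termsP[mf _].
  by rewrite subr_ge0; apply: wx fP (mwP _ _ mf) mf.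
exists a => [x wx|].
  rewrite aE big_seq; apply: sumr_ge0 => f fP; rewrite big_seq.
  by apply: sumr_ge0 => m mv; apply: ge0.
apply/seteqP; split=> x [wx /= h]; split=> //=.
  rewrite aE big_seq big1 // => f fP; rewrite big_seq big1 // => m /mem_min_list mv.
  have /PPs Pf := fP; have /min_termsP[mf h1] := h f Pf m mv.
  have /min_termsP[mwf h2] := wx f Pf _ (mwP _ _ mf).
  by apply/eqP; rewrite subr_eq0 eq_le h1 // h2.
move=> f /[dup] Pf /PPs fP m mv.
move: h; rewrite aE big_seq => /eqP; rewrite psumr_eq0; last first.
  by move=> g gP; rewrite big_seq; apply: sumr_ge0 => k kv; apply: ge0.
move=> /allP/(_ _ fP); rewrite fP /= big_seq psumr_eq0; last first.
  by move=> k kv; apply: ge0.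
have mv' : m \in min_list f v by apply/mem_min_list.
move=> /allP/(_ _ mv'); rewrite mv' /= subr_eq0 => /eqP e.
case/min_termsP: mv => mf _; apply/min_termsP; split=> // m' m'f; rewrite e.
by have /min_termsP[_] := wx f Pf _ (mwP _ _ mf); apply.
Qed.

Lemma refinement_fan (D : set 'rV[R]_N) :
  (forall w x, D w -> cone w x -> D x) -> finite_set (cone @` D) ->
  is_fan (cone @` D) /\ fan_support (cone @` D) = D.
Proof.
move=> Dup fin; split.
  split=> //.
  - by move=> _ [w _ <-]; exact: refinement_cone_polyhedral.
  - move=> _ F [w Dw <-] hF; have [v Fv eF] := refinement_face hF.
    exists v; last by rewrite eF.
    by case: hF => a _ eF'; move: Fv; rewrite eF' => -[/(Dup _ _ Dw)].
  - move=> _ _ [w _ <-] [v _ <-]; split; first exact: refinement_inter.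
    by rewrite setIC; exact: refinement_inter.
apply/seteqP; split=> x; first by case=> _ [w Dw <-] /(Dup _ _ Dw).
by move=> Dx; exists (cone x); [exists x|exact: refinement_cone_refl].
Qed.

End RefinementFan.

(** * The Dressian in coordinates *)

Lemma eqbitsE s t : eqbits s t = (s == t).
Proof.
elim: s t => [|a s IH] [|b t] //=; rewrite IH eqseq_cons.
by case: a; case: b.
Qed.

Lemma mem_dedup s x : (x \in dedup s) = (x \in s).
Proof.
elim: s => //= y s IH; rewrite hasfE inE; case: ifP => [/hasP[z zs]|_].
  by rewrite eqbitsE => /eqP->; rewrite -IH; case: eqP => // ->; rewrite zs.
by rewrite inE IH.
Qed.

Lemma dedup_uniq s : uniq (dedup s).
Proof.
elim: s => //= y s IH; rewrite hasfE; case: ifP => // /hasPn h /=.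
by rewrite IH andbT; apply/negP => /h; rewrite eqbitsE eqxx.
Qed.

Lemma sub_state_map (T : eqType) (f g : T -> bool) (l : seq T) :
  reflect {in l, forall c, f c -> g c} (sub_state (map f l) (map g l)).
Proof.
elim: l => [|c l IH] /=; first by apply: ReflectT.
case E: (if f c then g c else true); last first.
  apply: ReflectF => /(_ c (mem_head _ _)); move: E.
  by case: (f c) => // -> /(_ isT).
apply: (iffP IH) => h d; last by move=> dl; apply: h; rewrite inE dl orbT.
by rewrite inE => /orP[/eqP-> fc|/h//]; rewrite fc in E.
Qed.

Lemma pairs_okP (rs : seq three_term) w : pairs_ok (zstate (conds rs) w) ->
  {in rs, forall r, zero_at w (cond_u r) || zero_at w (cond_v r)}.
Proof.
elim: rs => [|r rs IH] //= /andP[hr hrs] r'; rewrite inE => /orP[/eqP->//|].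
exact: IH.
Qed.

Lemma mem_conds rs c : c \in conds rs ->
  exists2 r, r \in rs & c = cond_u r \/ c = cond_v r.
Proof.
case/flattenP=> _ /mapP[r rr ->]; rewrite !inE => /orP[]/eqP->; exists r; auto.
Qed.

Definition orient_ok (sg : seq int) (r : three_term) : bool :=
  let a := term_sign sg r.1.1 in
  let b := - term_sign sg r.1.2 in
  let c := term_sign sg r.2 in
  [&& all (mem [:: 1; -1]) [:: a; b; c], (if b == c then a == - b
    else if a == c then b == - a else (b == a) && (c == - a)) &
   uniq (rel_indices r)].

Definition signs_ok (sg : seq int) : bool :=
  all (fun k => nth 0 sg k \in [:: 1; -1]) (iota 0 20) && all (orient_ok sg) rels.

Definition orels (sg : seq int) : seq three_term := [seq orient sg r | r <- rels].
Arguments orels : simpl never.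
Arguments rels : simpl never.
Arguments conds : simpl never.
Arguments cells : simpl never.
Arguments cover : simpl never.
Arguments solutions : simpl never.

Lemma chiE (sg : seq int) i : chirotope36 sg i = nth 0 sg (lexpos i).
Proof. by []. Qed.

Lemma subsums_ge0 (cs : seq cond) V w :
  all (fun v => all (fun c => 0 <=? zval c v)%ZZ cs) V -> w \in subsums V ->
  {in cs, forall c, (0 <=? zval c w)%ZZ}.
Proof.
elim: V w => [|v V IH] w /=.
  by move=> _; rewrite inE => /eqP-> k _; rewrite /zval !nth_nil.
case/andP=> v0 V0; rewrite mem_cat => /orP[/(IH _ V0)//|/mapP[u uV ->] k kcs].
by rewrite zval_zlcD leZ0D ?(IH u V0 uV) //; exact: (allP v0 k kcs).
Qed.

Section Dressian.
Variables (R : realType) (sg : seq int).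
Hypothesis sgP : signs_ok sg.
Notation E := 'rV[R]_(plN 3 6).
Notation chi := (chirotope36 sg).
Notation rs := (orels sg).
Notation cs := (conds rs).
Implicit Types (x y : E) (r : three_term).

Lemma chi_ix k : (k < 20)%N -> chi (ix k) = nth 0 sg k.
Proof. by move=> k20; rewrite chiE ixK. Qed.

Lemma sg_pm1 k : (k < 20)%N -> nth 0 sg k \in [:: 1; -1].
Proof.
by move=> k20; case/andP: sgP => /allP/(_ k); rewrite mem_iota => /(_ k20).
Qed.

Lemma exp_dot_mon p x : exp_dot (mon p) x = x 0 (ix p.1) + x 0 (ix p.2).
Proof.
rewrite /exp_dot /mon; under eq_bigr do rewrite mnmDE natrD mulrDl !mnm1E.
have D k : \sum_i (ix k == i)%:R * x 0 i = x 0 (ix k).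
  rewrite (bigD1 (ix k)) //= eqxx mul1r big1 ?addr0 // => i ni.
  by rewrite eq_sym (negPf ni) mul0r.
by rewrite big_split /= !D.
Qed.

Lemma rels_lt20 r : r \in rels -> all (fun k => k < 20)%N (rel_indices r).
Proof.
have : all (fun r => all (fun k => k < 20)%N (rel_indices r)) rels by vm_compute.
by move/allP; apply.
Qed.

Lemma mon_neq p p' : (p.1 < 20)%N -> (p'.1 < 20)%N -> (p'.2 < 20)%N ->
  p.1 != p'.1 -> p.1 != p'.2 -> mon p != mon p'.
Proof.
move=> h h1 h2 n1 n2; apply/eqP => /mnmP/(_ (ix p.1)).
rewrite !mnmDE !mnm1E eqxx (ix_inj h1 h) (ix_inj h2 h).
by rewrite [p'.1 == _]eq_sym [p'.2 == _]eq_sym (negPf n1) (negPf n2).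
Qed.

Lemma mons_uniq r : r \in rels -> uniq [:: mon r.1.1; mon r.1.2; mon r.2].
Proof.
move=> rr; have /and5P[a1 a2 b1 b2 /and3P[c1 c2 _]] := rels_lt20 rr.
case/andP: sgP => _ /allP/(_ _ rr)/and3P[_ _] /=; rewrite !inE !negb_or.
case/and5P=> /and5P[? ? ? ? ?] ? /and3P[? ? ?] ? /andP[? _].
by rewrite !mon_neq //=.
Qed.

Lemma rel_poly_coef r m : (rel_poly R r)@_m =
  (mon r.1.1 == m)%:R - (mon r.1.2 == m)%:R + (mon r.2 == m)%:R.
Proof. by rewrite /rel_poly mcoeffD mcoeffB !mcoeffX. Qed.

Lemma rel_poly_supp r : r \in rels ->
  msupp (rel_poly R r) =i [:: mon r.1.1; mon r.1.2; mon r.2].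
Proof.
move=> rr m; have := mons_uniq rr; rewrite mcoeff_msupp rel_poly_coef /= !inE.
rewrite negb_or ![m == _]eq_sym => /and3P[/andP[n12 n13] n23 _].
case: (eqVneq _ m) n12 n13 => [<-|_]; rewrite ?[_ == mon r.1.1]eq_sym.
  by move=> /negPf-> /negPf->; rewrite subr0 addr0 oner_eq0.
case: (eqVneq _ m) n23 => [<-|_]; rewrite ?[_ == mon r.1.2]eq_sym.
  by move=> /negPf-> _ _; rewrite sub0r addr0 oppr_eq0 oner_eq0.
by case: (eqVneq _ m) => _ _ _ _; rewrite subr0 add0r ?oner_eq0 ?eqxx.
Qed.

Lemma term_sgn_mon (f : {mpoly R[plN 3 6]}) p (e : int) :
  (p.1 < 20)%N -> (p.2 < 20)%N -> f@_(mon p) = e%:~R ->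
  e * term_sign sg p \in [:: 1; -1] ->
  term_sgn chi f (mon p) = (e * term_sign sg p)%:~R.
Proof.
move=> h1 h2 fe; rewrite /term_sgn mevalZ mpolyXD mevalM !mevalXU fe !chi_ix //.
rewrite -!intrM -/(term_sign sg p) !inE.
by case/orP=> /eqP->; rewrite ?sgr1 ?rmorphN1 ?sgrN1.
Qed.

Lemma rel_term_sgn r : r \in rels ->
  [/\ term_sgn chi (rel_poly R r) (mon r.1.1) = (term_sign sg r.1.1)%:~R,
      term_sgn chi (rel_poly R r) (mon r.1.2) = (- term_sign sg r.1.2)%:~R &
      term_sgn chi (rel_poly R r) (mon r.2) = (term_sign sg r.2)%:~R].
Proof.
move=> rr; have /and5P[a1 a2 b1 b2 /and3P[c1 c2 _]] := rels_lt20 rr.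
case/andP: sgP => _ /allP/(_ _ rr)/and3P[/and4P[sa sb sc _] _ _].
have := mons_uniq rr; rewrite /= !inE negb_or => /and3P[/andP[n12 n13] n23 _].
split; [rewrite -[term_sign _ _]mul1r|rewrite -mulN1r|rewrite -[term_sign _ _]mul1r];
  apply: term_sgn_mon; rewrite ?mul1r ?mulN1r // rel_poly_coef eqxx.
- by rewrite ![_ == mon r.1.1]eq_sym (negPf n12) (negPf n13) subr0 addr0.
- by rewrite (negPf n12) [mon r.2 == _]eq_sym (negPf n23) sub0r addr0 rmorphN1.
- by rewrite (negPf n13) (negPf n23) subr0 add0r.
Qed.

Lemma orientP r : r \in rels -> let: (t, u, v) := orient sg r in
  exists2 s : R, s \in [:: 1; -1] &
  [/\ msupp (rel_poly R r) =i [:: mon t; mon u; mon v],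
      term_sgn chi (rel_poly R r) (mon t) = s,
      term_sgn chi (rel_poly R r) (mon u) = - s &
      term_sgn chi (rel_poly R r) (mon v) = - s].
Proof.
move=> rr; have [] := rel_term_sgn rr; have := rel_poly_supp rr.
case/andP: sgP => _ /allP/(_ _ rr)/and3P[/and4P[sa sb sc _]].
rewrite /orient; move: sa sb sc.
move: (term_sign sg r.1.1) (- term_sign sg r.1.2) (term_sign sg r.2) => a b c.
have pm (e : int) : e \in [:: 1; -1] -> (e%:~R : R) \in [:: 1; -1].
  by rewrite !inE => /orP[]/eqP->; rewrite ?rmorphN1 eqxx ?orbT.
move=> sa sb sc; case: ifP => [/eqP bc /eqP ab|_].
  move=> _ supp ea eb ec; case: r rr supp ea eb ec => [[t u] v] /= rr supp ea eb ec.
  exists a%:~R; first exact: pm.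
  by split=> //; rewrite ?eb ?ec -?bc ab rmorphN opprK.
case: ifP => [/eqP ac /eqP ba|_ /andP[/eqP ba /eqP ca]] _ supp ea eb ec.
  exists b%:~R; first exact: pm.
  split=> //; last 2 first.
  - by rewrite ea ba rmorphN opprK.
  - by rewrite ec -ac ba rmorphN opprK.
  by move=> m; rewrite supp !inE orbCA.
exists c%:~R; first exact: pm.
split=> //; last 2 first.
- by rewrite ea ca rmorphN opprK.
- by rewrite eb ba ca rmorphN opprK.
by move=> m; rewrite supp !inE orbA orbC.
Qed.

Lemma form_mon (t u : pair_idx) x :
  form (t, u) x = exp_dot (mon u) x - exp_dot (mon t) x.
Proof. by rewrite !exp_dot_mon /form /=; ring. Qed.

Lemma TropV_rel r x : r \in rels ->
  TropV chi (rel_poly R r) x <-> trop_rel (orient sg r) x.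
Proof.
move=> rr; have := orientP rr; case: (orient sg r) => [[t u] v].
case=> s s1 [supp et eu ev]; rewrite TropVP /trop_rel /cond_u /cond_v /=.
rewrite !form_mon !subr_ge0.
have ns : s != - s.
  by apply/eqP; move: s1; rewrite !inE => /orP[]/eqP->; lra.
have t_in : mon t \in msupp (rel_poly R r) by rewrite supp !inE eqxx.
have u_in : mon u \in msupp (rel_poly R r) by rewrite supp !inE eqxx orbT.
have v_in : mon v \in msupp (rel_poly R r) by rewrite supp !inE eqxx !orbT.
have ns1 : - s \in [:: 1; -1].
  by move: s1; rewrite !inE => /orP[]/eqP->; rewrite ?opprK eqxx ?orbT.
have onlyt m : m \in msupp (rel_poly R r) -> term_sgn chi (rel_poly R r) m = s ->
    m = mon t.
  rewrite supp !inE => /or3P[]/eqP-> //; rewrite ?eu ?ev => e;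
  by rewrite e eqxx in ns.
have onlyuv m : m \in msupp (rel_poly R r) ->
    term_sgn chi (rel_poly R r) m = - s -> m = mon u \/ m = mon v.
  rewrite supp !inE => /or3P[]/eqP->; rewrite ?et; auto.
  by move=> e; rewrite -e eqxx in ns.
split=> [h|[tu tv uv] s' s'1 m mf ms].
  have h' m : m \in msupp (rel_poly R r) ->
     term_sgn chi (rel_poly R r) m = - s -> exp_dot (mon t) x <= exp_dot m x.
    move=> mf ms; have [m' [m'f m's]] := h _ ns1 m mf ms.
    by rewrite opprK in m's; rewrite (onlyt m').
  have tu := h' _ u_in eu; have tv := h' _ v_in ev; split=> //.
  have [m' [m'f m's] le1] := h _ s1 _ t_in et.
  case: (onlyuv _ m'f m's) => e; rewrite e in le1; [left|right];
  by apply/eqP; rewrite subr_eq0 eq_le le1.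
have [es|es] : s' = s \/ s' = - s.
  move: s1 s'1; rewrite !inE => /orP[]/eqP-> /orP[]/eqP->; rewrite ?opprK; auto.
  rewrite es in ms *; rewrite (onlyt m mf ms).
  case: uv => /eqP; rewrite subr_eq0 => /eqP e.
    by exists (mon u); rewrite ?e.
  by exists (mon v); rewrite ?e.
rewrite es in ms *; rewrite opprK; exists (mon t); first by [].
by case: (onlyuv _ mf ms) => ->.
Qed.

Lemma DressianP x : Dressian R chi x <-> {in rs, forall r, trop_rel r x}.
Proof.
split=> [h _ /mapP[r rr ->]|h f /three_term_relationsP[r rr ->]].
  by apply/TropV_rel => //; apply: h; apply/three_term_relationsP; exists r.
by apply/TropV_rel => //; apply: h; apply: map_f.
Qed.

Lemma Dressian_form_ge0 x c : Dressian R chi x -> c \in cs -> 0 <= form c x.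
Proof.
by move=> /DressianP h /mem_conds[r /h[h1 h2 _] [] ->].
Qed.

Notation P := (three_term_relations R 3 6).
Let Ps := [seq rel_poly R r | r <- rels].

Lemma three_term_list f : P f <-> f \in Ps.
Proof.
by rewrite three_term_relationsP; split=> [[r rr ->]|/mapP[r rr ->]];
  [apply: map_f|exists r].
Qed.

(** On the Dressian the first term of an oriented relation is always minimal, so the initial form
    only records which of the other two terms tie with it. *)
Lemma refinement_cone_Dressian w x : Dressian R chi w ->
  refinement_cone P w x <->
  Dressian R chi x /\ {in cs, forall c, form c w = 0 -> form c x = 0}.
Proof.
move=> /DressianP Dw; rewrite (refinement_coneP three_term_list).
have O r : r \in rels -> let: (t, u, v) := orient sg r in
    [/\ (t, u) \in cs, (t, v) \in cs, trop_rel (orient sg r) w &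
       msupp (rel_poly R r) =i [:: mon t; mon u; mon v]].
  move=> rr; have rr' : orient sg r \in rs by apply: map_f.
  have := orientP rr; have := Dw _ rr'; have [] := conds_mem rr'.
  by case: (orient sg r) => [[t u] v] h1 h2 h3 [s _ [h4 _ _ _]].
split=> [h|[/DressianP Dx h] f m m' /mapP[r rr ->]].
  have H r : r \in rels -> let: (t, u, v) := orient sg r in
      [/\ trop_rel (orient sg r) x,
        form (t, u) w = 0 -> form (t, u) x = 0 &
        form (t, v) w = 0 -> form (t, v) x = 0].
    move=> rr; have := O r rr; have {h} := fun m m' => h (rel_poly R r) m m'.
    case: (orient sg r) => [[t u] v] h [_ _ [/= tu tv uv] supp].
    rewrite /cond_u /cond_v /= in tu tv uv *.
    have {}h m m' := h m m' (map_f (rel_poly R) rr).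
    have in3 k : k \in [:: mon t; mon u; mon v] -> k \in msupp (rel_poly R r).
      by rewrite supp.
    have tw : min_terms (rel_poly R r) w (mon t).
      apply/min_termsP; split; first by apply: in3; rewrite mem_head.
      move: tu tv; rewrite !form_mon !subr_ge0 => tu tv k.
      by rewrite supp !inE => /or3P[]/eqP->.
    have hu := h _ (mon u) tw (in3 _ _); have hv := h _ (mon v) tw (in3 _ _).
    have {}hu : 0 <= form (t, u) x.
      by rewrite form_mon subr_ge0 hu // !inE eqxx orbT.
    have {}hv : 0 <= form (t, v) x.
      by rewrite form_mon subr_ge0 hv // !inE eqxx !orbT.
    have Z p : p \in [:: u; v] -> form (t, p) w = 0 -> form (t, p) x <= 0.
      rewrite !form_mon => pin /eqP; rewrite subr_eq0 subr_le0 => /eqP e.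
      apply: h; last by apply: in3; rewrite mem_head.
      apply/min_termsP; split.
        by apply: in3; move: pin; rewrite !inE => /orP[]/eqP->;
          rewrite eqxx ?orbT.
      by move=> k kf; rewrite e; case/min_termsP: tw => _; apply.
    have Zu : form (t, u) w = 0 -> form (t, u) x = 0.
      by move=> /Z h0; apply/eqP; rewrite eq_le hu h0 // mem_head.
    have Zv : form (t, v) w = 0 -> form (t, v) x = 0.
      by move=> /Z h0; apply/eqP; rewrite eq_le hv h0 // !inE eqxx orbT.
    split=> //; split=> //; case: uv => [/Zu|/Zv]; auto.
  split.
    apply/DressianP => _ /mapP[r rr ->]; have := H r rr.
    by case: (orient sg r) => [[t u] v] [].
  move=> c /mem_conds[_ /mapP[r rr ->]]; have := H r rr.
  by case: (orient sg r) => [[t u] v] [_ hu hv] [] ->.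
have := O r rr; have := Dx _ (map_f (orient sg) rr).
case: (orient sg r) => [[t u] v] [xu xv xuv] [tuc tvc [wu wv wuv] supp].
rewrite /cond_u /cond_v /= in xu xv xuv wu wv wuv.
move=> /min_termsP[]; rewrite !supp.
have le_t k : k \in [:: mon t; mon u; mon v] -> exp_dot (mon t) x <= exp_dot k x.
  move: xu xv; rewrite !form_mon !subr_ge0 => xu xv.
  by rewrite !inE => /or3P[]/eqP->.
have T_in : mon t \in [:: mon t; mon u; mon v] by rewrite mem_head.
have eqt p : (t, p) \in cs -> (forall k, k \in msupp (rel_poly R r) ->
     exp_dot (mon p) w <= exp_dot k w) -> 0 <= form (t, p) w ->
    exp_dot (mon p) x = exp_dot (mon t) x.
  move=> pc hp p0; apply/eqP; rewrite -subr_eq0 -form_mon; apply/eqP.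
  apply: h => //; apply/eqP; rewrite eq_le p0 andbT form_mon subr_le0.
  by apply: hp; rewrite supp.
by rewrite !inE => /or3P[]/eqP-> hm m'f; rewrite ?(eqt _ _ hm) //; apply: le_t;
  rewrite !inE.
Qed.

End Dressian.

(** * The lineality space *)

Definition lin_gen (j : nat) : zvec :=
  [seq if j.+1 \in l then 1%ZZ else 0%ZZ | l <- lex36].

(* Three times the coordinates of a preimage in R^6 of a vector of the lineality
   space, from [x_134 - x_234 = y_1 - y_2] and its analogues. *)
Definition lin_coords (b : zvec) : zvec :=
  let x k := nth 0%ZZ b k in
  let y1 := (x 0%N + x 4%N + x 1%N - 2 * x 10%N)%ZZ in
  [:: y1; y1 + 3 * (x 10%N - x 4%N); y1 + 3 * (x 10%N - x 1%N);
      y1 + 3 * (x 10%N - x 0%N); y1 + 3 * (x 11%N - x 0%N);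
      y1 + 3 * (x 12%N - x 0%N)]%ZZ.

Definition zsum3 (y : zvec) (l : seq nat) : Z :=
  foldr (fun j s => nth 0 y j.-1 + s)%ZZ 0%ZZ l.

(** The first test fixes the dimension 6 of the common kernel, the second places this kernel in the
    lineality space, and the third is the reverse inclusion. *)
Definition check_lin (cs : seq cond) : bool :=
  let B := solutions cs in
  [&& size B == 6%N,
      all (fun b => all (fun k => 3 * nth 0 b k =?
                           zsum3 (lin_coords b) (nth [::] lex36 k))%ZZ
             (iota 0 20)) B &
      all (fun j => all (fun c => zval c (lin_gen j) =? 0)%ZZ cs) (iota 0 6)].

Section Lineality.
Variable R : realType.
Notation E := 'rV[R]_(plN 3 6).
Notation L := (lineality R 3 6).

Definition lin (y : 'rV[R]_6) : E := \row_i \sum_(j in val (pl_index i)) y 0 j.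

Lemma linE (y : 'rV[R]_6) : lin y = \sum_j y 0 j *: vec R (lin_gen j).
Proof.
apply/rowP => i; rewrite mxE summxE big_mkcond; apply: eq_bigr => j _.
rewrite !mxE (nth_map [::]) ?lexpos_lt // nth_lexpos mem_setkey.
by case: ifP; rewrite ?zr1 ?zr0 ?mulr1 ?mulr0.
Qed.

Lemma lin_is_linear : linear lin.
Proof.
move=> a x y; apply/rowP => i; rewrite !mxE mulr_sumr -big_split.
by apply: eq_bigr => j _; rewrite !mxE.
Qed.

HB.instance Definition _ := GRing.isLinear.Build R 'rV[R]_6 E _ lin lin_is_linear.

Lemma lin_coords_sound (b : zvec) :
  all (fun k => 3 * nth 0 b k =? zsum3 (lin_coords b) (nth [::] lex36 k))%ZZ
      (iota 0 20) ->
  lin (\row_j ((3%:R)^-1 * zr R (nth 0%ZZ (lin_coords b) j))) = vec R b.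
Proof.
move=> /allP h; apply/rowP => i; rewrite !mxE.
have := h (lexpos i); rewrite mem_iota lexpos_lt => /(_ isT)/Z.eqb_spec.
rewrite nth_lexpos => e.
have zsumE (l : seq 'I_6) : zr R (zsum3 (lin_coords b) [seq j.+1 | j : 'I_6 <- l]) =
    \sum_(j <- l) zr R (nth 0%ZZ (lin_coords b) j).
  by elim: l => [|j l IH]; rewrite ?big_nil //= zrD IH big_cons.
under eq_bigr do rewrite mxE.
rewrite -mulr_sumr -big_enum /= -zsumE -/(setkey _) -e zrM mulrA.
by rewrite -[zr R 3%ZZ]/(3%:R) mulVf ?mul1r // pnatr_eq0.
Qed.

Lemma lineality_kernel (cs : seq cond) : all cond_lt20 cs -> check_lin cs ->
  L = form_kernel cs.
Proof.
move=> cs20 /and3P[_ /allP hB /allP hg]; apply/seteqP; split=> x.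
  case=> y _ <- c cc; have c20 := allP cs20 _ cc.
  rewrite -[\row_i _]/(lin y) linE raddf_sum /= big1 // => j _.
  rewrite formZ form_vec //; have := hg j; rewrite mem_iota => /(_ (ltn_ord j)).
  by move/allP/(_ _ cc)/Z.eqb_spec ->; rewrite zr0 mulr0.
have [h _] := @solutions_sound R cs cs20.
move=> /h xB; rewrite (coord_span (X := in_tuple (map (vec R) (solutions cs))) xB).
apply: (big_ind (fun z => L z)).
- by exists 0 => //; rewrite -/(lin 0) linear0.
- by move=> _ _ [y _ <-] [y' _ <-]; exists (y + y') => //; rewrite -/(lin _) linearD.
- move=> i _; have iB : (i < size (solutions cs))%N.
    by rewrite -(size_map (vec R)) ltn_ord.
  rewrite (nth_map [::]) // -(lin_coords_sound (hB _ (mem_nth _ iB))) -linearZ.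
  by eexists.
Qed.

End Lineality.

Section Dim.
Variables (R : realType) (N : nat).

Lemma has_dim_uniq (A : set 'rV[R]_N) d d' : has_dim A d -> has_dim A d' -> d = d'.
Proof.
move=> [U [AU minU] <-] [V [AV minV] <-].
by congr (\dim _); apply: subv_anti; rewrite (minU _ AV) (minV _ AU).
Qed.

Lemma has_dim_modE (L C : set 'rV[R]_N) e d c : L `<=` C -> has_dim L e ->
  has_dim C c -> has_dim_mod L C d <-> c = (d + e)%N.
Proof.
move=> LC dL dC; rewrite /has_dim_mod (setUidl LC); split.
  by case=> e' /(has_dim_uniq dL) <- /(has_dim_uniq dC).
by move=> ec; exists e => //; rewrite -ec.
Qed.

End Dim.

(** * Lifting to the tropical Grassmannian *)

Section ExpBound.
Variable R : realType.

Lemma exp_sum_bound (T : eqType) (s : seq T) (A : R) (b d : T -> R) :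
  {in s, forall i, 0 <= b i /\ 0 < d i} ->
  (forall S : R, 0 <= S -> A <= \sum_(i <- s) b i * expR (- (S * d i))) -> A <= 0.
Proof.
move=> h hS; rewrite leNgt; apply/negP => A0.
pose K := \sum_(i <- s) b i / d i.
have K0 : 0 <= K.
  rewrite /K big_seq; apply: sumr_ge0 => i /h[b0 d0].
  by rewrite divr_ge0 // ltW.
(* From [expR (- t) <= 1 / t] follows [A <= K / S]; for this [S] it reads [K + A <= K]. *)
pose S := K / A + 1; have S0 : 0 < S by rewrite ltr_wpDl // divr_ge0 // ltW.
have : A <= K / S.
  apply: le_trans (hS S (ltW S0)) _; rewrite /K mulr_suml !big_seq.
  apply: ler_sum => i /h[b0 d0]; rewrite -mulrA ler_wpM2l // expRN -invfM.
  have Sd : 0 < S * d i by rewrite mulr_gt0.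
  rewrite [d i * S]mulrC lef_pV2 ?posrE ?expR_gt0 //.
  by apply: le_trans (expR_ge1Dx _); rewrite lerDr.
rewrite ler_pdivlMr // /S mulrDr mulr1 mulrCA divff ?gt_eqF // mulr1.
by rewrite gerDl leNgt A0.
Qed.

End ExpBound.

Section TropLift.
Variables (R : realType) (N : nat) (chi : 'I_N -> int) (x v : 'rV[R]_N) (C : R).
Variable f : {mpoly R[N]}.
Hypothesis chi1 : forall i, chi i \in [:: 1; -1].
(* [f] vanishes at points with signs [chi] and valuations [S x + O(1)]. *)
Hypothesis lifts : forall S : R, 0 <= S -> exists2 q : 'I_N -> R,
  (forall i, near C (q i) ((S *: x + v) 0 i)) &
  f.@[fun i => (chi i)%:~R * q i] = 0.

Let mono (q : 'I_N -> R) (m : 'X_{1..N}) : R := \prod_i q i ^+ m i.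
Let deg (m : 'X_{1..N}) : R := \sum_i C *+ m i.

Lemma near_mono (q : 'I_N -> R) (z : 'rV[R]_N) m : (forall i, near C (q i) (z 0 i)) ->
  near (deg m) (mono q m) (exp_dot m z).
Proof.
move=> hq; rewrite /deg /mono /exp_dot.
apply: (big_ind3 (fun a b c => near a b c)).
- by have := near_expR (0 : R); rewrite oppr0 expR0.
- by move=> *; apply: nearM.
move=> i _; elim: (m i) => [|n IH].
  by have := near_expR (0 : R); rewrite oppr0 expR0 mulr0n mul0r expr0.
by rewrite mulrS exprS -natr1 mulrDl mul1r addrC [_ + z 0 i]addrC addrC; apply: nearM.
Qed.

(** Suppose a term [m] of sign [s] lies strictly below all terms of the opposite sign at [x]. Since
    [f] vanishes at the lifts, the absolute value of the term [m] is at most the sum of those of the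
    opposite terms. Divided by the monomial [m], that sum decays exponentially in [S], forcing the
    coefficient of [m] to be 0. *)
Lemma TropV_lift : TropV chi f x.
Proof.
apply/TropVP => s s1 m mf ms; apply: contrapT => hno.
have hno' m' : m' \in msupp f -> term_sgn chi f m' = - s ->
    exp_dot m x < exp_dot m' x.
  by move=> m'f m's; rewrite ltNge; apply/negP => le1; apply: hno; exists m'.
have s2 : s * s = 1.
  by move: s1; rewrite !inE => /orP[]/eqP->; rewrite ?mulrNN mul1r.
have ns : s != - s.
  by apply/eqP; move: s1; rewrite !inE => /orP[]/eqP->; lra.
pose e k : R := \prod_i (chi i)%:~R ^+ k i.
have e1 k : `|e k| = 1.
  rewrite normr_prod big1 // => i _; rewrite normrX.
  have := chi1 i; rewrite !inE => /orP[]/eqP->;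
  by rewrite ?rmorphN1 ?normrN normr1 expr1n.
have sgE k : term_sgn chi f k = Num.sg (f@_k * e k).
  by rewrite /term_sgn mevalZ mevalX.
have fE k : f@_k * e k = term_sgn chi f k * `|f@_k|.
  by rewrite sgE [LHS]numEsg normrM e1 mulr1.
have sgpm k : k \in msupp f -> term_sgn chi f k = s \/ term_sgn chi f k = - s.
  rewrite mcoeff_msupp => fk; have nz : f@_k * e k != 0.
    by rewrite mulf_neq0 // -normr_gt0 e1.
  rewrite sgE; move: s1; rewrite !inE => /orP[]/eqP->; rewrite ?opprK;
  by case: sgrP nz => // _ _; auto.
(* [B k] gathers what does not depend on [S]: the coefficient, the errors of both monomials and the
   fixed shift [v]. *)
pose B k := `|f@_k| * expR (deg k - exp_dot k v + (deg m + exp_dot m v)).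
pose d k := exp_dot k x - exp_dot m x.
have : `|f@_m| <= 0.
  apply: (@exp_sum_bound R _ [seq k <- msupp f | term_sgn chi f k == - s] _ B d).
    move=> k; rewrite mem_filter => /andP[/eqP ks kf]; split.
      by rewrite mulr_ge0 ?expR_ge0.
    by rewrite subr_gt0; apply: hno'.
  move=> S S0; have [q hq fq] := lifts S0.
  have nm k := near_mono k hq.
  have posm k : 0 < mono q k := near_gt0 (nm k).
  have wpos k : 0 <= `|f@_k| * mono q k by rewrite mulr_ge0 // ltW.
  have ev : \sum_(k <- msupp f) (s * term_sgn chi f k) * (`|f@_k| * mono q k) = 0.
    transitivity (s * f.@[fun i => (chi i)%:~R * q i]); last by rewrite fq mulr0.
    rewrite mevalE mulr_sumr; apply: eq_bigr => k _.
    rewrite -mulrA; congr (_ * _); rewrite mulrA -fE -mulrA; congr (_ * _).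
    by rewrite -big_split; apply: eq_bigr => i _; rewrite exprMn.
  have le1 : `|f@_m| * mono q m <=
     \sum_(k <- msupp f | term_sgn chi f k == - s) `|f@_k| * mono q k.
    have -> : \sum_(k <- msupp f | term_sgn chi f k == - s) `|f@_k| * mono q k =
       \sum_(k <- msupp f | term_sgn chi f k != - s) `|f@_k| * mono q k.
      apply/eqP; rewrite eq_sym -subr_eq0; apply/eqP; rewrite -[RHS]ev.
      rewrite [RHS](bigID (fun k => term_sgn chi f k == - s)) /= addrC -sumrN.
      congr (_ + _); last first.
        by apply: eq_bigr => k /eqP->; rewrite mulrN s2 mulN1r.
      rewrite big_seq_cond [RHS]big_seq_cond; apply: eq_bigr => k /andP[kf].
      by case: (sgpm k kf) => ->; rewrite ?eqxx // s2 mul1r.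
    rewrite big_mkcond (bigD1_seq m) ?msupp_uniq //= ms ns.
    by rewrite lerDl; apply: sumr_ge0 => k _; case: ifP.
  have -> : `|f@_m| = (`|f@_m| * mono q m) / mono q m by rewrite mulfK ?gt_eqF.
  apply: (@le_trans _ _ ((\sum_(k <- msupp f | term_sgn chi f k == - s)
     `|f@_k| * mono q k) / mono q m)).
    by rewrite ler_wpM2r // invr_ge0 ltW.
  rewrite big_filter mulr_suml; apply: ler_sum => k _.
  rewrite /B -!mulrA ler_wpM2l // -expRD.
  have /andP[_ h] := nearM (nm k) (nearV (nm m)).
  apply: le_trans h _; rewrite ler_expR /d !exp_dotD !exp_dotZ; lra.
by rewrite normr_le0; move: mf; rewrite mcoeff_msupp => /negPf->.
Qed.

End TropLift.

(** * The fan structure of the Dressian *)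

Lemma ltZ0_neq (a : Z) : (0 <=? a)%ZZ -> a <> 0%ZZ -> (0 <? a)%ZZ.
Proof. lia. Qed.

Lemma rel_eval_orient (R : realType) (sg : seq int) r (q : nat -> R) :
  orient_ok sg r -> pos_rel (orient sg r) q ->
  rel_eval (fun k => (nth 0 sg k)%:~R * q k) r = 0.
Proof.
move=> /and3P[_ + _]; rewrite /rel_eval /orient.
have E a b : (nth 0 sg a)%:~R * q a * ((nth 0 sg b)%:~R * q b) =
    (term_sign sg (a, b))%:~R * (q a * q b).
  by rewrite /term_sign /= intrM mulrACA.
rewrite !E -!surjective_pairing {E}.
move: (term_sign sg r.1.1) (term_sign sg r.2) => a c.
have -> : term_sign sg r.1.2 = - - term_sign sg r.1.2 by rewrite opprK.
move: (- term_sign sg r.1.2) => b; rewrite opprK; case: ifP => [/eqP <- /eqP ->|_].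
  by rewrite /pos_rel => ->; rewrite !rmorphN; ring.
case: ifP => [/eqP <- /eqP ->|_ /andP[/eqP -> /eqP ->]];
  by rewrite /pos_rel /= => ->; rewrite !rmorphN; ring.
Qed.

Lemma filter_andP (T : eqType) (p : pred T) (l : seq T) x :
  reflect (p x /\ x \in l) (x \in [seq y <- l | p y]).
Proof. by rewrite mem_filter; apply: andP. Qed.

Lemma card_image_seq (U : Type) (g : bitseq -> U) (l : seq bitseq) :
  uniq l -> {in l &, injective g} -> (g @` [set s | s \in l] #= `I_(size l))%card.
Proof.
move=> ul ginj; have -> : g @` [set s | s \in l] =
    (fun i => g (nth [::] l i)) @` `I_(size l).
  apply/seteqP; split=> C.
    by case=> s /= sl <-; exists (index s l); rewrite /= ?index_mem ?nth_index.
  by case=> i /= il <-; exists (nth [::] l i) => //=; apply: mem_nth.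
apply: inj_card_eq => i j; rewrite !inE /= => il jl.
move/(ginj _ _ (mem_nth _ il) (mem_nth _ jl))/eqP.
by rewrite nth_uniq // => /eqP.
Qed.

Lemma f_vectorE (l : seq bitseq) (h : bitseq -> nat) (fv : seq nat) d :
  [seq count (fun p => p.2 == k) [seq (s, h s) | s <- l] | k <- [:: 7; 8; 9; 10]%N]
    = fv ->
  d \in [:: 1; 2; 3; 4]%N -> count (fun s => h s == d + 6)%N l = nth 0%N fv d.-1.
Proof.
by move=> <-; rewrite !inE => /or4P[]/eqP->; rewrite /= count_map.
Qed.

Section Main.
Variables (R : realType) (sg : seq int) (bases : seq (seq nat)) (fv : seq nat).
Notation rs := (orels sg).
Notation cs := (conds rs).
Hypothesis sgP : signs_ok sg.
Hypothesis linP : check_lin cs.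
Hypothesis cellsP : check_cells rs bases fv.
Notation E := 'rV[R]_(plN 3 6).
Notation chi := (chirotope36 sg).
Notation Dr := (Dressian R chi).
Notation L := (lineality R 3 6).
Notation cone := (refinement_cone (three_term_relations R 3 6)).
Notation cl := (cells cs (cover rs)).
Implicit Types (x y : E).

Lemma rs_lt20 : all rel_lt20 rs.
Proof. by case/and5P: cellsP. Qed.

Lemma cs_lt20 : all cond_lt20 cs.
Proof.
apply/allP => c /mem_conds[r rr h].
by have /andP[] := allP rs_lt20 _ rr; case: h => ->.
Qed.

(** No spurious cells: sums of generators inherit the inequalities tested in [check_cells], and
    [pairs_ok] makes each minimum attained, so every listed state occurs at an integer point. *)
Lemma cells_state s : s \in cl -> exists2 w, s = zstate cs w &
  Dr (vec R w) /\ {in cs, forall c, (0 <=? zval c w)%ZZ}.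
Proof.
move=> scl; have pok : pairs_ok s.
  by case/and5P: cellsP => _ _ /allP/(_ _ scl).
move: scl; rewrite mem_dedup => /mapP[w /flatten_mapP[c cc wc] es].
have /andP[cB cV] : all (fun b => all (fun c => zval c b =? 0)%ZZ cs) c.1
        && all (fun v => all (fun c => 0 <=? zval c v)%ZZ cs) c.2.
  by case/and5P: cellsP => _ /allP/(_ _ cc).
have w0 := subsums_ge0 cV wc.
exists w => //; split=> //; apply/DressianP => // r rr.
have [uc vc] := conds_mem rr; rewrite es in pok.
have /orP h := pairs_okP pok rr.
have u20 := allP cs_lt20 _ uc; have v20 := allP cs_lt20 _ vc.
split; rewrite ?form_vec ?zr_ge0 ?w0 //.
by case: h => /Z.eqb_spec->; [left|right].
Qed.

Lemma state_of x : Dr x -> exists2 s, s \in cl &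
  s = [seq form c x == 0 | c <- cs].
Proof.
move=> Dx; have [c cc xc] : in_cones (cover rs) x.
  by apply: cover_sound rs_lt20 _; apply/(DressianP sgP).
have /andP[cB cV] : all (fun b => all (fun c => zval c b =? 0)%ZZ cs) c.1
        && all (fun v => all (fun c => 0 <=? zval c v)%ZZ cs) c.2.
  by case/and5P: cellsP => _ /allP/(_ _ cc).
have [w wc hw] := subsums_sound cs_lt20 cB cV xc.
exists (zstate cs w).
  by rewrite mem_dedup; apply: map_f; apply/flatten_mapP; exists c.
by rewrite /zstate; apply/eq_in_map => k /hw[-> _ _].
Qed.

Definition zcell (s : bitseq) : set E :=
  [set x | Dr x /\ {in mask s cs, forall c, form c x = 0}].

Lemma cone_zcell x : Dr x -> cone x = zcell [seq form c x == 0 | c <- cs].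
Proof.
move=> Dx; apply/seteqP; split=> y.
  move=> /(refinement_cone_Dressian sgP _ Dx)[Dy h]; split=> // c.
  by rewrite -filter_mask mem_filter => /andP[/eqP c0 cc]; apply: h.
move=> [Dy h]; apply/(refinement_cone_Dressian sgP _ Dx); split=> // c cc c0.
by apply: h; rewrite -filter_mask mem_filter c0 eqxx.
Qed.

Lemma state_vec w : [seq form c (vec R w) == 0 | c <- cs] = zstate cs w.
Proof.
rewrite /zstate; apply/eq_in_map => c cc; rewrite form_vec ?zr_eq0 //.
exact: (allP cs_lt20).
Qed.

Lemma Sigma_cells : Dressian_fan R chi = zcell @` [set s | s \in cl].
Proof.
apply/seteqP; split=> C.
  move=> [x Dx <-]; have [s scl es] := state_of Dx; exists s => //.
  by rewrite es -cone_zcell.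
move=> [s scl <-]; have [w es [Dw _]] := cells_state scl; exists (vec R w) => //.
by rewrite cone_zcell // state_vec es.
Qed.

Lemma zcell_sub s s' : s \in cl -> s' \in cl ->
  sub_state s' s <-> zcell s `<=` zcell s'.
Proof.
move=> scl s'cl; have [w es [Dw _]] := cells_state scl.
have [w' es' [Dw' _]] := cells_state s'cl; rewrite es es'; split.
  move=> /sub_state_map h x [Dx hx]; split=> // c.
  rewrite -filter_mask mem_filter => /andP[c0 cc]; apply: hx.
  by rewrite -filter_mask mem_filter cc h.
move=> h; apply/sub_state_map => c cc c0.
have : zcell (zstate cs w) (vec R w).
  by rewrite -state_vec -cone_zcell //; exact: refinement_cone_refl.
move/h=> [_ /(_ c)]; rewrite -filter_mask mem_filter c0 cc => /(_ isT).
have c20 := allP cs_lt20 _ cc.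
by rewrite form_vec // => /eqP; rewrite zr_eq0 => /eqP->.
Qed.

Lemma sub_state_anti (T : eqType) (f g : T -> bool) (l : seq T) :
  sub_state (map f l) (map g l) -> sub_state (map g l) (map f l) ->
  map f l = map g l.
Proof.
move=> /sub_state_map h1 /sub_state_map h2; apply/eq_in_map => c cc.
by apply/idP/idP; [apply: h1|apply: h2].
Qed.

Lemma zcell_inj s s' : s \in cl -> s' \in cl -> zcell s = zcell s' -> s = s'.
Proof.
move=> scl s'cl e; have [w es _] := cells_state scl.
have [w' es' _] := cells_state s'cl.
have h1 : sub_state s' s by apply/zcell_sub => //; rewrite e.
have h2 : sub_state s s' by apply/zcell_sub => //; rewrite e.
by move: h1 h2; rewrite es es' => h1 h2; apply: sub_state_anti.
Qed.

Lemma lin_kernel : L = form_kernel cs.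
Proof. exact: lineality_kernel cs_lt20 linP. Qed.

Lemma kernel_zcell s : L `<=` zcell s.
Proof.
rewrite lin_kernel => x xk; split.
  apply/(DressianP sgP) => r rr; have [uc vc] := conds_mem rr.
  by rewrite /trop_rel !xk // lexx; split=> //; left.
by move=> c /mem_mask; apply: xk.
Qed.

Lemma lin_dim : has_dim L 6.
Proof.
have [h hd] := @solutions_sound R cs cs_lt20.
exists <<map (vec R) (solutions cs)>>%VS.
  split=> [x|W hW]; first by rewrite lin_kernel => /h.
  by apply/subvP => x /h xk; apply: hW; rewrite lin_kernel.
by rewrite hd; case/and3P: linP => /eqP.
Qed.

(** The cell spans the whole kernel of its ties: for [u] in that kernel, [K w + u] stays in the cell
    once [K] is large, because all other conditions are positive at [w]. *)
Lemma zcell_dim s : s \in cl -> has_dim (zcell s) (cell_dim cs s).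
Proof.
move=> scl; have [w es [Dw w0]] := cells_state scl.
have m20 : all cond_lt20 (mask s cs).
  by apply/allP => c /mem_mask; apply: (allP cs_lt20).
have [h hd] := @solutions_sound R _ m20.
exists <<map (vec R) (solutions (mask s cs))>>%VS => //.
split=> [x [_ hx]|W hW]; first exact/h.
have wW : vec R w \in W.
  apply: hW; rewrite es -state_vec -cone_zcell //; exact: refinement_cone_refl.
apply/subvP => u /h uk.
have [|K K0 hK] := @dominating_factor R _ [seq c <- cs | 0 < form c (vec R w)]
  (fun c => form c (vec R w)) (fun c => - form c u).
  by move=> c; rewrite mem_filter => /andP[].
suff : zcell s (K *: vec R w + u).
  by move/hW => KW; rewrite -(addKr (K *: vec R w) u) memvD // -scaleNr memvZ.
have zero c : c \in cs -> form c (vec R w) = 0 -> form c (K *: vec R w + u) = 0.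
  move=> cc c0; rewrite formD formZ c0 mulr0 add0r; apply: uk.
  rewrite es -state_vec -filter_mask mem_filter c0 eqxx //.
have pos c : c \in cs -> 0 <= form c (K *: vec R w + u).
  move=> cc; have := Dressian_form_ge0 sgP Dw cc; rewrite le_eqVlt.
  case/orP=> [/eqP c0|c0]; first by rewrite zero.
  by rewrite formD formZ -lerBlDr sub0r; apply: hK; rewrite mem_filter c0.
split.
  apply/(DressianP sgP) => r rr; have [uc vc] := conds_mem rr.
  have [_ _ h0] := (DressianP sgP _).1 Dw r rr.
  split; [exact: pos|exact: pos|].
  by case: h0 => e0; [left|right]; apply: zero.
move=> c; rewrite es -state_vec -filter_mask mem_filter => /andP[/eqP c0 cc].
exact: zero.
Qed.

Lemma zcell_dim_mod s d : s \in cl ->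
  has_dim_mod L (zcell s) d <-> cell_dim cs s = (d + 6)%N.
Proof.
move=> scl; exact: (has_dim_modE _ (@kernel_zcell s) lin_dim (zcell_dim scl)).
Qed.

Lemma cells_top s : s \in cl -> exists s', [/\ s' \in cl, cell_dim cs s' = 10%N,
  has (liftable rs s') bases & sub_state s' s].
Proof.
move=> scl; case/and5P: cellsP => _ _ _ /allP/(_ _ scl) + _.
rewrite hasfE => /hasP[s' /mapP[p]]; rewrite mem_filter.
case/andP=> hp /mapP[t tcl ep] es' sub; exists s'.
move: hp; rewrite es' ep /=; case: ifP => // /eqP dt; rewrite hasfE => lt.
by split=> //; move: sub; rewrite es' ep.
Qed.

Lemma Dressian_subset_TropG : Dr `<=` TropG R chi.
Proof.
move=> x Dx f If; have [s scl es] := state_of Dx.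
have [s' [s'cl _ /hasP[base _ lft] sub]] := cells_top scl.
have [w es' [Dw w0]] := cells_state s'cl.
have wok : {in rs, forall r, zero_at w (cond_u r) || zero_at w (cond_v r)}.
  apply: pairs_okP; rewrite -es'.
  by case/and5P: cellsP => _ _ /allP/(_ _ s'cl).
rewrite es' in lft.
have [C C0 [M M0 [used hused lifts]]] := @liftableP R rs w wok base lft.
have chi1 i : chi i \in [:: 1; -1].
  by rewrite -(lexposK i) chi_ix ?lexpos_lt // (sg_pm1 sgP) // lexpos_lt.
apply: (@TropV_lift R _ chi x (M *: vec R w) C f chi1) => S S0.
have [|q qn qrel] := lifts (S *: x + M *: vec R w).
  move=> c cc; have c20 := allP cs_lt20 _ cc.
  rewrite formD !formZ form_vec //; split=> [c0|cn0].
    rewrite c0 zr0 mulr0 addr0.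
    move: sub; rewrite es es' => /sub_state_map/(_ c cc); rewrite c0 => /(_ isT).
    by move/eqP->; rewrite mulr0.
  (* Integrality of [w]: a positive value is at least 1, so [M w] alone provides the depth [M], and
     [S x] contributes nothing negative. *)
  have z1 : 1 <= zr R (zval c w) by rewrite zr_ge1; exact: ltZ0_neq (w0 c cc) cn0.
  have := Dressian_form_ge0 sgP Dx cc => x0.
  rewrite -[X in X <= _]add0r lerD ?mulr_ge0 //.
  by rewrite -[X in X <= _]mulr1 ler_wpM2l.
(* Restoring the signs turns the positive relations for [q] back into three-term relations for
   [p]. *)
pose p k := (nth 0 sg k)%:~R * q k.
have q0 k : (k < 20)%N -> 0 < q k by move=> /qn/near_gt0.
have p0 k : (k < 20)%N -> p k != 0.
  move=> k20; rewrite /p mulf_eq0 negb_or (gt_eqF (q0 k k20)) andbT intr_eq0.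
  by have := sg_pm1 sgP k20; rewrite !inE => /orP[]/eqP->.
have hold : rels_hold p used.
  move=> k /qrel[ks]; rewrite size_map in ks.
  rewrite (nth_map rel0) //; set r := nth rel0 rels k.
  have rr : r \in rels by apply: mem_nth.
  by apply: rel_eval_orient; case/andP: sgP => _ /allP/(_ _ rr).
have {}hold := @iter_close_sound _ p p0 6%N _ hold.
have [A hA] : exists A : 'M[R]_(3, 6),
    forall k, (k < 20)%N -> minor A (ix k) = p k.
  apply: realize => // r rr; rewrite -(nth_index rel0 rr).
  apply: hold; apply: (allP hused); rewrite mem_iota.
  by rewrite -[(0 + 30)%N]/(size rels) index_mem.
exists (fun i => q (lexpos i)) => [i|].
  by have := qn _ (lexpos_lt i); rewrite lexposK.
rewrite -(meval_pluecker A If); apply: meval_eq => i.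
have := hA _ (lexpos_lt i); rewrite lexposK => ->.
exact: (congr1 (fun e : int => e%:~R * q (lexpos i)) (chiE sg i)).
Qed.

Lemma Dressian_TropG : Dr = TropG R chi.
Proof.
apply/seteqP; split; first exact: Dressian_subset_TropG.
move=> x Gx f /three_term_relationsP[r rr ->]; apply: Gx.
exact: rel_poly_pluecker.
Qed.

Lemma Sigma_finite : finite_set (Dressian_fan R chi).
Proof.
rewrite Sigma_cells; apply: finite_image.
exact: finite_seq.
Qed.

Lemma Sigma_count d : num_cones_mod L (Dressian_fan R chi) d
  (count (fun s => cell_dim cs s == d + 6)%N cl).
Proof.
rewrite /num_cones_mod Sigma_cells -size_filter.
have -> : [set C | (zcell @` [set s | s \in cl]) C /\ has_dim_mod L C d] =
    zcell @` [set s | s \in [seq s <- cl | cell_dim cs s == d + 6]%N].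
  apply/seteqP; split=> C.
    case=> -[s scl <-] /(zcell_dim_mod _ scl) ds; exists s => //.
    by apply/filter_andP; rewrite ds.
  case=> s /filter_andP[/eqP ds scl] <-; split; first by exists s.
  exact/zcell_dim_mod.
apply: card_image_seq; first by rewrite filter_uniq // dedup_uniq.
move=> s t /filter_andP[_ scl] /filter_andP[_ tcl]; exact: zcell_inj.
Qed.

Lemma fvE d : d \in [:: 1; 2; 3; 4]%N ->
  count (fun s => cell_dim cs s == d + 6)%N cl = nth 0%N fv d.-1.
Proof.
by case/and5P: cellsP => _ _ _ _ /eqP; exact: f_vectorE.
Qed.

Lemma Dressian_fan_structure (f1 f2 f3 f4 : nat) : fv = [:: f1; f2; f3; f4] ->
  let Sigma := Dressian_fan R chi in
  [/\ is_fan_mod L Sigma /\ fan_support Sigma = Dr,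
      pure_mod L Sigma 4,
      Dr = TropG R chi &
      [/\ num_cones_mod L Sigma 1 f1,
          num_cones_mod L Sigma 2 f2,
          num_cones_mod L Sigma 3 f3 &
          num_cones_mod L Sigma 4 f4]].
Proof.
move=> efv Sigma; split.
- have [||fan supp] := refinement_fan (@three_term_list R) (D := Dr).
  + by move=> w x Dw /(refinement_cone_Dressian sgP _ Dw)[].
  + exact: Sigma_finite.
  split=> //; split=> // C; rewrite /Sigma Sigma_cells => -[s scl <-].
  apply/seteqP; split=> x; last first.
    rewrite lin_kernel => xk; have xk' : form_kernel cs (- x).
      by move=> c cc; rewrite raddfN /= xk // oppr0.
    by split; apply: kernel_zcell; rewrite lin_kernel.
  case=> -[Dx _] [Dnx _]; rewrite lin_kernel => c cc; apply/eqP.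
  rewrite eq_le (Dressian_form_ge0 sgP Dx cc) andbT -oppr_ge0 -raddfN /=.
  exact: (Dressian_form_ge0 sgP Dnx cc).
- move=> C; rewrite /Sigma Sigma_cells => -[s scl <-] mx.
  have [s' [s'cl ds' _ /(zcell_sub scl s'cl) sub]] := cells_top scl.
  have e : zcell s' = zcell s by apply: mx => //; exists s'.
  by apply/zcell_dim_mod => //; rewrite -(zcell_inj s'cl scl e) ds'.
- exact: Dressian_TropG.
have H d : d \in [:: 1; 2; 3; 4]%N -> num_cones_mod L Sigma d (nth 0%N fv d.-1).
  by move=> d4; rewrite -fvE //; exact: Sigma_count.
rewrite efv in H; split.
- exact: (H 1%N).
- exact: (H 2%N).
- exact: (H 3%N).
- exact: (H 4%N).
Qed.

End Main.

(** * The four chirotopes: data and verification by computation *)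

Definition signs1 : seq int :=
  [:: 1; 1; 1; 1; 1; 1; 1; 1; -1; -1; 1; 1; 1; 1; 1; -1; 1; 1; 1; 1].
Definition signs2 : seq int :=
  [:: 1; 1; 1; 1; 1; 1; 1; 1; 1; 1; 1; 1; 1; 1; 1; 1; 1; 1; -1; -1].
Definition signs3 : seq int :=
  [:: 1; 1; 1; 1; 1; 1; 1; 1; 1; 1; 1; 1; 1; 1; 1; 1; 1; 1; 1; -1].
Definition signs4 : seq int :=
  [:: 1; 1; 1; 1; 1; 1; 1; 1; 1; 1; 1; 1; 1; 1; 1; 1; 1; 1; 1; 1].

(* Transcendence bases of Pluecker coordinates found by computer search: a
   single one serves all maximal cells of the last three chirotopes, while the
   first chirotope has no basis with only subtraction-free steps and needs six. *)
Definition bases1 : seq (seq nat) :=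
  [:: [:: 0; 2; 7; 8; 10; 11; 12; 14; 15; 16];
      [:: 5; 6; 7; 8; 9; 10; 14; 15; 16; 18];
      [:: 0; 1; 2; 6; 8; 10; 13; 14; 15; 18];
      [:: 0; 2; 6; 7; 8; 10; 16; 17; 18; 19];
      [:: 0; 1; 2; 7; 10; 13; 14; 15; 16; 18];
      [:: 0; 2; 6; 7; 8; 10; 11; 13; 14; 16]]%N.
Definition bases2 : seq (seq nat) := [:: [:: 0; 3; 6; 7; 8; 10; 12; 15; 17; 18]]%N.
Definition bases3 : seq (seq nat) := [:: [:: 0; 1; 3; 7; 10; 13; 14; 17; 18; 19]]%N.
Definition bases4 : seq (seq nat) := [:: [:: 0; 2; 3; 4; 5; 9; 10; 16; 18; 19]]%N.

Lemma signs1_ok : signs_ok signs1 && check_lin (conds (orels signs1)).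
Proof. by vm_compute. Qed.
Lemma signs2_ok : signs_ok signs2 && check_lin (conds (orels signs2)).
Proof. by vm_compute. Qed.
Lemma signs3_ok : signs_ok signs3 && check_lin (conds (orels signs3)).
Proof. by vm_compute. Qed.
Lemma signs4_ok : signs_ok signs4 && check_lin (conds (orels signs4)).
Proof. by vm_compute. Qed.

Lemma cells1_ok : check_cells (orels signs1) bases1 [:: 15; 60; 90; 45]%N.
Proof. by vm_compute. Qed.
Lemma cells2_ok : check_cells (orels signs2) bases2 [:: 15; 60; 89; 44]%N.
Proof. by vm_compute. Qed.
Lemma cells3_ok : check_cells (orels signs3) bases3 [:: 14; 55; 82; 41]%N.
Proof. by vm_compute. Qed.
Lemma cells4_ok : check_cells (orels signs4) bases4 [:: 16; 66; 98; 48]%N.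
Proof. by vm_compute. Qed.

Theorem theorem5p1 (R : realType) (signs : seq int) (f1 f2 f3 f4 : nat) :
  [\/ signs = [:: 1; 1; 1; 1; 1; 1; 1; 1; -1; -1; 1; 1; 1; 1; 1; -1; 1; 1; 1; 1]
        /\ (f1, f2, f3, f4) = (15, 60, 90, 45)%N,
      signs = [:: 1; 1; 1; 1; 1; 1; 1; 1; 1; 1; 1; 1; 1; 1; 1; 1; 1; 1; -1; -1]
        /\ (f1, f2, f3, f4) = (15, 60, 89, 44)%N,
      signs = [:: 1; 1; 1; 1; 1; 1; 1; 1; 1; 1; 1; 1; 1; 1; 1; 1; 1; 1; 1; -1]
        /\ (f1, f2, f3, f4) = (14, 55, 82, 41)%N |
      signs = [:: 1; 1; 1; 1; 1; 1; 1; 1; 1; 1; 1; 1; 1; 1; 1; 1; 1; 1; 1; 1]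
        /\ (f1, f2, f3, f4) = (16, 66, 98, 48)%N] ->
  let chi := chirotope36 signs in
  let Sigma := Dressian_fan R chi in
  let L := lineality R 3 6 in
  [/\ is_fan_mod L Sigma /\ fan_support Sigma = Dressian R chi,
      pure_mod L Sigma 4,
      Dressian R chi = TropG R chi &
      [/\ num_cones_mod L Sigma 1 f1,
          num_cones_mod L Sigma 2 f2,
          num_cones_mod L Sigma 3 f3 &
          num_cones_mod L Sigma 4 f4]].
Proof.
case=> -[-> [-> -> -> ->]].
- have /andP[ok lin] := signs1_ok.
  exact (@Dressian_fan_structure R signs1 bases1 _ ok lin cells1_ok _ _ _ _ erefl).
- have /andP[ok lin] := signs2_ok.
  exact (@Dressian_fan_structure R signs2 bases2 _ ok lin cells2_ok _ _ _ _ erefl).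
- have /andP[ok lin] := signs3_ok.
  exact (@Dressian_fan_structure R signs3 bases3 _ ok lin cells3_ok _ _ _ _ erefl).
- have /andP[ok lin] := signs4_ok.
  exact (@Dressian_fan_structure R signs4 bases4 _ ok lin cells4_ok _ _ _ _ erefl).
Qed.
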